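(* Let $P(x)=T_6(x)$ and $Q(x)=T_2(x)+T_3(x)$, where $T_n(x)=\cos(n\arccos x)$ is the $n$-th Chebyshev polynomial. Let $\Gamma$ be the curve obtained from the real interval $[-\sqrt3/2,\sqrt3/2]$ by a small shift, preserving the end-points, into the positive imaginary direction, and let $\gamma=P(\Gamma)$, a closed curve through the point $-1=P(-\sqrt3/2)=P(\sqrt3/2)$. Let $g(z)=Q(P^{-1}(z))$ on $\gamma$, analytically continued from $-1$ along $\gamma$ in the positive direction (the direction in which $\Gamma$ goes from $-\sqrt3/2$ to $\sqrt3/2$), starting with the value $Q(-\sqrt3/2)$. Then $I(\gamma,g,t)=\frac1{2\pi i}\int_\gamma\frac{g(z)\,dz}{z-t}\equiv0$ for $t$ near $\infty$, while the branches of $g$ on the two sides of $-1\in\gamma$ cannot be obtained from one another by any local analytic continuation.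
   Context: On $\gamma=P(\Gamma)$ the branch of $P^{-1}$ is the one with values on $\Gamma$, so $g(P(x))=Q(x)$ for $x\in\Gamma$. The branches of $g$ on the two sides of $-1$ are those corresponding to $P^{-1}$ near $-\sqrt3/2$ (just after $-1$) and near $\sqrt3/2$ (just before returning to $-1$). ''Local analytic continuation'' means analytic continuation along curves inside an arbitrarily small neighborhood of the point $-1$, avoiding singularities. *)

(* Defs.v *)
From Stdlib Require Import Reals Lra Lia.
From Coquelicot Require Import Coquelicot.
Open Scope R_scope.

Fixpoint chebyshev (n : nat) (x : C) : C :=
  match n with
  | O => RtoC 1
  | S m => match m with
           | O => x
           | S k => (RtoC 2 * x * chebyshev m x - chebyshev k x)%C
           end
  end.

Lemma chebyshev_cos (n : nat) (th : R) :
  chebyshev n (RtoC (cos th)) = RtoC (cos (INR n * th)).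
Proof.
  assert (H : chebyshev n (RtoC (cos th)) = RtoC (cos (INR n * th)) /\
              chebyshev (S n) (RtoC (cos th)) = RtoC (cos (INR (S n) * th))).
  { induction n as [|n [IH0 IH1]].
    - split; simpl; f_equal.
      + rewrite Rmult_0_l, cos_0; reflexivity.
      + f_equal; ring.
    - split; [exact IH1|].
      change (chebyshev (S (S n)) (RtoC (cos th)))
        with (RtoC 2 * RtoC (cos th) * chebyshev (S n) (RtoC (cos th))
              - chebyshev n (RtoC (cos th)))%C.
      rewrite IH0, IH1, <- !RtoC_mult, <- RtoC_minus; f_equal.
      replace (INR (S (S n)) * th) with (INR (S n) * th + th)
        by (rewrite (S_INR (S n)); ring).
      replace (INR n * th) with (INR (S n) * th - th)
        by (rewrite (S_INR n); ring).
      rewrite cos_plus, cos_minus; ring. }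
  exact (proj1 H).
Qed.

Lemma chebyshev_acos (n : nat) (x : R) (hx : -1 <= x <= 1) :
  chebyshev n (RtoC x) = RtoC (cos (INR n * acos x)).
Proof. rewrite <- chebyshev_cos, cos_acos; [reflexivity | exact hx]. Qed.

(** Paths are functions [R -> C] of which only the values on [[0, 1]] matter. *)

Definition path_derive (c : R -> C) (u : R) : C :=
  (Derive (fun v => Re (c v)) u, Derive (fun v => Im (c v)) u).

Definition C1_path (c : R -> C) : Prop :=
  forall u, ex_derive (fun v => Re (c v)) u /\ ex_derive (fun v => Im (c v)) u /\
            continuous (path_derive c) u.

Inductive piecewise_C1 (c : R -> C) : R -> R -> Prop :=
| piecewise_C1_smooth (a b : R) (d : R -> C) :
    a <= b -> C1_path d -> (forall u, a <= u <= b -> c u = d u) ->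
    piecewise_C1 c a b
| piecewise_C1_cat (a m b : R) :
    piecewise_C1 c a m -> piecewise_C1 c m b -> piecewise_C1 c a b.

(** Every point of the real interval [[-l, l]] is moved vertically, the interior
    points upwards by less than [delta] and the end-points not at all: since the
    real part increases from [-l] to [l], [Gam] is a parametrization of such a
    graph [x + i h(x)], traversed from left to right. *)
Record small_upward_shift (l delta : R) (Gam : R -> C) : Prop := {
  shift_C1 : piecewise_C1 Gam 0 1;
  shift_start : Gam 0 = RtoC (- l);
  shift_end : Gam 1 = RtoC l;
  shift_Re : forall u v, 0 <= u -> u < v -> v <= 1 -> Re (Gam u) < Re (Gam v);
  shift_Im : forall u, 0 < u < 1 -> 0 < Im (Gam u) < delta
}.

Definition germ_eq (z0 : C) (f g : C -> C) : Prop :=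
  locally z0 (fun z => f z = g z).

Definition analytic_at (f : C -> C) (z0 : C) : Prop :=
  exists a : nat -> C,
    locally z0 (fun z => is_pseries (K := C_AbsRing) (V := C_NormedModule)
                           a (z - z0)%C (f z)).

(** [F u] represents a germ at [c u]; the germs [F u], for [u] in the interval
    [D], are analytic continuations of one another along the path [c]. *)
Definition continuation_along (D : R -> Prop) (c : R -> C) (F : R -> C -> C) : Prop :=
  forall u, D u ->
    analytic_at (F u) (c u) /\
    within D (locally u) (fun v => germ_eq (c v) (F v) (F u)).

(** The germ of [f] at [z] can be continued to the germ of [g] at [w] along a path
    contained in [U]. *)
Definition obtained_within (U : C -> Prop) (z : C) (f : C -> C) (w : C) (g : C -> C)
  : Prop :=
  exists (c : R -> C) (F : R -> C -> C),
    (forall u, continuous c u) /\ c 0 = z /\ c 1 = w /\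
    (forall u, 0 <= u <= 1 -> U (c u)) /\
    continuation_along (fun u => 0 <= u <= 1) c F /\
    germ_eq z (F 0) f /\ germ_eq w (F 1) g.

(** The branch of [P^-1] along [P o Gam] with values on [Gam]. The path [P o Gam]
    may cross itself, so that this branch is a function of the parameter, [phi u]
    being its germ at [P (Gam u)]. At the end-points, which may be branch points of
    [P^-1], only the value is prescribed. *)
Record inverse_branch_along (P : C -> C) (Gam : R -> C) (phi : R -> C -> C) : Prop := {
  inverse_branch_continuation :
    continuation_along (fun u => 0 < u < 1) (fun u => P (Gam u)) phi;
  inverse_branch_inverse :
    forall u, 0 < u < 1 -> germ_eq (P (Gam u)) (fun z => P (phi u z)) (fun z => z);
  inverse_branch_value :
    forall u, 0 <= u <= 1 -> phi u (P (Gam u)) = Gam u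
}.

(** [I] is the value at [t] of [1/(2 pi i) int_gam g(z) dz / (z - t)], the value of
    [g] at the point [gam u] of the path being [g u (gam u)]. *)
Definition is_cauchy_integral (gam : R -> C) (g : R -> C -> C) (t I : C) : Prop :=
  exists J : C,
    is_RInt (V := C_R_NormedModule)
      (fun u => (g u (gam u) / (gam u - t) * path_derive gam u)%C) 0 1 J /\
    I = (/ (RtoC 2 * RtoC PI * Ci) * J)%C.

(* Main.v *)
Require Import Defs.
From Stdlib Require Import Reals Lra Lia Classical.
From Coquelicot Require Import Coquelicot.
Open Scope R_scope.

(** Write P = T_6 and Q = T_2 + T_3.

    The integral vanishes because P = T_3 o T_2 = T_2 o T_3.  On the curve g(P(x)) = Q(x),
    so the integral is that of Q P' / (P - t) along Gam.  In the moment of Q P^n P' the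
    summand with T_2 is a polynomial differential in T_2 and the summand with T_3 is one
    in T_3 ([moment_primitive]); both T_2 and T_3 take equal values at the ends of Gam, so
    each of them maps Gam to a closed curve and every moment is zero.  Hence Q / (P - t)
    may be replaced by Q (P / t)^n / (P - t), for every n, without changing the integral,
    and for large t these functions tend to 0 uniformly on Gam ([vanishing_integral]).

    The two branches are told apart by the identities
      Q(x) - 1/2 = (4x^2 - 3) (x + 1/2)   and   (P(x) + 1) / 2 = x^2 (4x^2 - 3)^2,
    which give ([side_gap])
      |Q(x) - 1/2|^2 - |(P(x) + 1) / 2| = |4x^2 - 3|^2 (Re x + 1/4).
    So a point z <> -1 and a value q = Q(x), where P(x) = z, determine on which side of
    the line Re x = -1/4 the preimage x lies, and P maps that line outside the disc
    |z + 1| < 1/2 ([separating_line]).  The branch just after -1 has preimages on the left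
    of the line and the branch just before the return to -1 has them on the right.
    A continuation of g never leaves the values Q(x) with P(x) = z: they are the
    solutions q of a polynomial equation over z ([preimage_of_branch_equation]), and a
    polynomial equation between analytic germs is permanent under continuation, as the
    zeros of an analytic function that is not locally zero are isolated
    ([continuation_equation]).  Along a continuation within the punctured disc the two
    sides of [side_gap] therefore never vanish (4x^2 - 3 <> 0 because z <> -1), and by
    continuity their sign is constant ([side_invariant]). *)

(** * Complex-valued functions *)

Local Notation is_derive_path :=
  (is_derive (K := R_AbsRing) (V := C_R_NormedModule)) (only parsing).
Local Notation is_pseries_C :=
  (is_pseries (K := C_AbsRing) (V := C_NormedModule)) (only parsing).

Lemma Cmod_le_Re_Im (z : C) : Cmod z <= Rabs (Re z) + Rabs (Im z).
Proof.
  destruct z as [a b]; unfold Cmod; simpl fst; simpl snd.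
  unfold Re, Im; simpl.
  apply Rsqr_incr_0_var.
  - rewrite Rsqr_sqrt by nra. unfold Rsqr.
    generalize (Rabs_pos a) (Rabs_pos b); intros.
    assert (E : forall x, Rabs x * Rabs x = x * x)
      by (intros x; rewrite <- Rabs_mult; apply Rabs_pos_eq; nra).
    generalize (E a) (E b); nra.
  - generalize (Rabs_pos a) (Rabs_pos b); lra.
Qed.

Lemma Cmod_sqr (z : C) : Cmod z ^ 2 = Re z ^ 2 + Im z ^ 2.
Proof. unfold Cmod; rewrite pow2_sqrt; [reflexivity|]. nra. Qed.

Lemma Rabs_Re_le_Cmod (z : C) : Rabs (Re z) <= Cmod z.
Proof. generalize (Rmax_Cmod z) (Rmax_l (Rabs (fst z)) (Rabs (snd z))); unfold Re; lra. Qed.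

Lemma Rabs_Im_le_Cmod (z : C) : Rabs (Im z) <= Cmod z.
Proof. generalize (Rmax_Cmod z) (Rmax_r (Rabs (fst z)) (Rabs (snd z))); unfold Im; lra. Qed.

Lemma Csqrt_exists (z : C) : exists y : C, (y * y = z)%C.
Proof.
  destruct z as [p q].
  set (m := Cmod (p, q)).
  assert (Hm : m * m = p * p + q * q).
  { unfold m, Cmod; simpl fst; simpl snd. rewrite sqrt_sqrt by nra. ring. }
  assert (Hm0 : 0 <= m) by apply Cmod_ge_0.
  assert (Hp : 0 <= (m + p) / 2 /\ 0 <= (m - p) / 2).
  { assert (Rabs p <= m) by apply (Rabs_Re_le_Cmod (p, q)).
    generalize (Rle_abs p) (Rle_abs (- p)); rewrite Rabs_Ropp; lra. }
  assert (Hs : sqrt ((m + p) / 2) * sqrt ((m - p) / 2) = Rabs q / 2).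
  { rewrite <- sqrt_mult by apply Hp.
    replace ((m + p) / 2 * ((m - p) / 2)) with (Rsqr (q / 2)) by (unfold Rsqr; nra).
    rewrite sqrt_Rsqr_abs. unfold Rdiv.
    rewrite Rabs_mult, (Rabs_pos_eq (/ 2)) by lra. reflexivity. }
  generalize (sqrt_sqrt _ (proj1 Hp)) (sqrt_sqrt _ (proj2 Hp)).
  set (x := sqrt ((m + p) / 2)) in *. set (y := sqrt ((m - p) / 2)) in *.
  intros Hx Hy.
  destruct (Rle_lt_dec 0 q) as [Hq|Hq].
  - rewrite Rabs_pos_eq in Hs by exact Hq.
    exists (x, y). apply injective_projections; simpl; lra.
  - rewrite Rabs_left in Hs by exact Hq.
    exists (x, - y). apply injective_projections; simpl; lra.
Qed.

Lemma Cmod_zero_of_geometric (J : C) (K : R) :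
  (forall n, Cmod J <= K * (/ 2) ^ n) -> J = RtoC 0.
Proof.
  intros H. apply Cmod_eq_0, Rle_antisym; [|apply Cmod_ge_0].
  apply (is_lim_seq_le (fun _ => Cmod J) (fun n => K * (/ 2) ^ n) (Cmod J) 0 H).
  - apply is_lim_seq_const.
  - replace (Finite 0) with (Rbar_mult K 0) by (simpl; f_equal; ring).
    apply is_lim_seq_scal_l, is_lim_seq_geom. rewrite Rabs_pos_eq; lra.
Qed.

(** The neighbourhoods of [C] are those of the product [R * R]; estimates with [Cmod]
    describe the same ones. *)
Lemma locally_Cmod (z0 : C) (A : C -> Prop) :
  locally z0 A <-> exists rho, 0 < rho /\ forall z, Cmod (z - z0) < rho -> A z.
Proof.
  split.
  - intros [e He]. exists e; split; [apply cond_pos|].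
    intros z Hz. apply He.
    split.
    + change (Rabs (Re (z - z0)) < e). generalize (Rabs_Re_le_Cmod (z - z0)); lra.
    + change (Rabs (Im (z - z0)) < e). generalize (Rabs_Im_le_Cmod (z - z0)); lra.
  - intros (rho & Hr & H).
    assert (Hr2 : 0 < rho / 2) by lra.
    exists (mkposreal _ Hr2). intros z [H1 H2]. apply H.
    change (Rabs (Re (z-z0)) < rho / 2) in H1.
    change (Rabs (Im (z-z0)) < rho / 2) in H2.
    generalize (Cmod_le_Re_Im (z - z0)); lra.
Qed.

Lemma filterlim_C_iff {T : Type} {F : (T -> Prop) -> Prop} {FF : Filter F}
  (f : T -> C) (l : C) :
  filterlim f F (locally l) <->
  filterlim (fun u => Re (f u)) F (locally (Re l)) /\
  filterlim (fun u => Im (f u)) F (locally (Im l)).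
Proof.
  split.
  - intros H; split.
    + apply (filterlim_comp _ _ _ f (fst : C -> R) _ (locally l)); [exact H|].
      destruct l; apply continuous_fst.
    + apply (filterlim_comp _ _ _ f (snd : C -> R) _ (locally l)); [exact H|].
      destruct l; apply continuous_snd.
  - intros [H1 H2].
    apply (filterlim_ext (fun u => (Re (f u), Im (f u)))).
    + intros u; destruct (f u); reflexivity.
    + intros A [e He]. apply (filterlim_pair _ _ H1 H2).
      exists (ball (Re l) e) (ball (Im l) e); [apply locally_ball..|].
      intros x y Hx Hy; apply He; split; assumption.
Qed.

Lemma continuous_C_iff {U : UniformSpace} (f : U -> C) (x : U) :
  continuous f x <->
  continuous (fun u => Re (f u)) x /\ continuous (fun u => Im (f u)) x.
Proof. apply filterlim_C_iff. Qed.

Lemma continuous_Cplus {U : UniformSpace} (f g : U -> C) (x : U) :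
  continuous f x -> continuous g x -> continuous (fun u => f u + g u)%C x.
Proof.
  rewrite !continuous_C_iff; intros [f1 f2] [g1 g2]; split.
  - apply (continuous_plus (V := R_NormedModule) _ _ x f1 g1).
  - apply (continuous_plus (V := R_NormedModule) _ _ x f2 g2).
Qed.

Lemma continuous_Cmult {U : UniformSpace} (f g : U -> C) (x : U) :
  continuous f x -> continuous g x -> continuous (fun u => f u * g u)%C x.
Proof.
  rewrite !continuous_C_iff; intros [f1 f2] [g1 g2]; split.
  - apply (continuous_minus (V := R_NormedModule));
      apply (continuous_mult (K := R_AbsRing)); assumption.
  - apply (continuous_plus (V := R_NormedModule));
      apply (continuous_mult (K := R_AbsRing)); assumption.
Qed.

Lemma continuous_Cpow {U : UniformSpace} (f : U -> C) (x : U) (n : nat) :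
  continuous f x -> continuous (fun u => f u ^ n)%C x.
Proof.
  intros Hf; induction n as [|n IH]; simpl.
  - apply continuous_const.
  - apply continuous_Cmult; assumption.
Qed.

Lemma continuous_Cinv {U : UniformSpace} (f : U -> C) (x : U) :
  continuous f x -> f x <> RtoC 0 -> continuous (fun u => / f u)%C x.
Proof.
  intros Hf H0; apply continuous_C_iff in Hf as [f1 f2].
  assert (Hn : continuous (fun u => / (Re (f u) ^ 2 + Im (f u) ^ 2)) x).
  { apply (continuous_comp (fun u => Re (f u) ^ 2 + Im (f u) ^ 2) Rinv).
    - apply (continuous_plus (V := R_NormedModule)).
      + apply (continuous_ext (fun u => Re (f u) * Re (f u)));
          [intros u; simpl; ring|].
        apply (continuous_mult (K := R_AbsRing)); assumption.
      + apply (continuous_ext (fun u => Im (f u) * Im (f u)));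
          [intros u; simpl; ring|].
        apply (continuous_mult (K := R_AbsRing)); assumption.
    - apply continuous_Rinv. intros E. apply H0.
      destruct (f x) as [a b]; unfold Re, Im in E; simpl in E.
      apply injective_projections; simpl; nra. }
  apply continuous_C_iff; split.
  - apply (continuous_mult (K := R_AbsRing) (fun u => Re (f u))); assumption.
  - apply (continuous_mult (K := R_AbsRing) (fun u => - Im (f u))); [|assumption].
    apply (continuous_opp (V := R_NormedModule)); assumption.
Qed.

Lemma continuous_Cmod {U : UniformSpace} (f : U -> C) (x : U) :
  continuous f x -> continuous (fun u => Cmod (f u)) x.
Proof.
  intros Hf; apply continuous_C_iff in Hf as [f1 f2].
  apply (continuous_comp (fun u => fst (f u) ^ 2 + snd (f u) ^ 2) sqrt);
    [|apply continuous_sqrt].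
  apply (continuous_plus (V := R_NormedModule)).
  - apply (continuous_ext (fun u => Re (f u) * Re (f u)));
      [intros u; unfold Re; simpl; ring|].
    apply (continuous_mult (K := R_AbsRing)); assumption.
  - apply (continuous_ext (fun u => Im (f u) * Im (f u)));
      [intros u; unfold Im; simpl; ring|].
    apply (continuous_mult (K := R_AbsRing)); assumption.
Qed.

Lemma is_derive_C_iff (c : R -> C) (u : R) (l : C) :
  is_derive_path c u l <->
  is_derive (fun v => Re (c v)) u (Re l) /\ is_derive (fun v => Im (c v)) u (Im l).
Proof.
  split.
  - intros H; split.
    + apply (filterdiff_comp' (K := R_AbsRing) (V := C_R_NormedModule)
               c (fst : C -> R) u _ fst H).
      apply filterdiff_linear, is_linear_fst.
    + apply (filterdiff_comp' (K := R_AbsRing) (V := C_R_NormedModule)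
               c (snd : C -> R) u _ snd H).
      apply filterdiff_linear, is_linear_snd.
  - intros [H1 H2].
    apply (is_derive_ext (V := C_R_NormedModule) (fun u => (Re (c u), Im (c u)))).
    + intros v; destruct (c v); reflexivity.
    + unfold is_derive.
      apply (filterdiff_ext_lin (V := C_R_NormedModule) _ (fun y : R => (y * Re l, y * Im l))).
      2: intros y; destruct l; reflexivity.
      eapply (filterdiff_comp'_2 (W := C_R_NormedModule) (fun v => Re (c v))
        (fun v => Im (c v)) (fun x y : R => (x, y)) u _ _ (fun x y : R => (x, y)) H1 H2).
      apply (filterdiff_ext_lin (V := C_R_NormedModule) _ (fun t : R * R => t)).
      2: intros [x y]; reflexivity.
      apply (filterdiff_ext (V := C_R_NormedModule) (fun t : R * R => t)).
      intros [x y]; reflexivity.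
      apply filterdiff_id.
Qed.

Lemma path_derive_of_is_derive (c : R -> C) (u : R) (l : C) :
  is_derive_path c u l -> path_derive c u = l.
Proof.
  intros H. apply is_derive_C_iff in H as [H1 H2].
  apply injective_projections; apply is_derive_unique; assumption.
Qed.

Lemma is_derive_Cmult (c d : R -> C) (u : R) (lc ld : C) :
  is_derive_path c u lc ->
  is_derive_path d u ld ->
  is_derive_path (fun v => c v * d v)%C u
    (lc * d u + c u * ld)%C.
Proof.
  rewrite !is_derive_C_iff. intros [c1 c2] [d1 d2].
  assert (M : forall f g : R -> R, forall lf lg, is_derive f u lf -> is_derive g u lg ->
    is_derive (fun v => f v * g v) u (lf * g u + f u * lg)).
  { intros f g lf lg Hf Hg. exact (is_derive_mult f g u lf lg Hf Hg Rmult_comm). }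
  split.
  - replace (Re (lc * d u + c u * ld)) with
      ((Re lc * Re (d u) + Re (c u) * Re ld) - (Im lc * Im (d u) + Im (c u) * Im ld))
      by (unfold Re, Im; simpl; ring).
    apply (is_derive_minus (V := R_NormedModule)
      (fun v => Re (c v) * Re (d v)) (fun v => Im (c v) * Im (d v))); apply M; assumption.
  - replace (Im (lc * d u + c u * ld)) with
      ((Re lc * Im (d u) + Re (c u) * Im ld) + (Im lc * Re (d u) + Im (c u) * Re ld))
      by (unfold Re, Im; simpl; ring).
    apply (is_derive_plus (V := R_NormedModule)
      (fun v => Re (c v) * Im (d v)) (fun v => Im (c v) * Re (d v))); apply M; assumption.
Qed.

(** * Power series and isolated zeros *)

Lemma is_pseries_C_iff (a : nat -> C) (w l : C) :
  is_pseries_C a w l <->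
  is_series (fun n => Re (w ^ n * a n)%C) (Re l) /\
  is_series (fun n => Im (w ^ n * a n)%C) (Im l).
Proof.
  assert (Hp : forall n, pow_n (K := C_Ring) w n = (w ^ n)%C).
  { induction n as [|n IH]; simpl; [reflexivity|]. rewrite IH; reflexivity. }
  assert (Hs : forall n,
    Re (sum_n (fun k => scal (pow_n (w : C_AbsRing) k) (a k : C_NormedModule)) n)
      = sum_n (fun k => Re (w ^ k * a k)%C) n /\
    Im (sum_n (fun k => scal (pow_n (w : C_AbsRing) k) (a k : C_NormedModule)) n)
      = sum_n (fun k => Im (w ^ k * a k)%C) n).
  { intros n; induction n as [|n [IH1 IH2]].
    - rewrite !sum_O, <- Hp; split; reflexivity.
    - rewrite !sum_Sn, <- IH1, <- IH2, <- Hp; split; reflexivity. }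
  unfold is_pseries, is_series.
  split.
  - intros H. apply filterlim_C_iff in H as [H1 H2]; split;
      (eapply filterlim_ext; [|eassumption]); intros n; apply Hs.
  - intros [H1 H2]. apply filterlim_C_iff; split;
      (eapply filterlim_ext; [|eassumption]); intros n; symmetry; apply Hs.
Qed.

Lemma is_series_term_bounded (u : nat -> R) (l : R) :
  is_series u l -> exists M, forall n, Rabs (u n) <= M.
Proof.
  intros H.
  destruct (maj_by_pos u) as [M [_ HM]].
  - exists 0. apply is_lim_seq_Reals, ex_series_lim_0. exists l; exact H.
  - exists M; exact HM.
Qed.

(** The bound on the coefficients is what convergence at one point of modulus [rho]
    provides; it makes all estimates below explicit. *)
Definition power_expansion (f : C -> C) (z0 : C) (a : nat -> C) (rho M : R) : Prop :=
  0 < rho /\ (forall n, Cmod (a n) * rho ^ n <= M) /\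
  forall z, Cmod (z - z0) < rho ->
    is_pseries_C a (z - z0)%C (f z).

(** Half of the radius of the given disc is kept, so that the series still converges at
    a point of modulus [rho] and its terms are bounded there. *)
Lemma analytic_at_expansion (f : C -> C) (z0 : C) :
  analytic_at f z0 -> exists a rho M, power_expansion f z0 a rho M.
Proof.
  intros [a Ha]. apply locally_Cmod in Ha as (rho & Hr & H).
  exists a, (rho / 2).
  assert (Hz : Cmod (z0 + RtoC (rho / 2) - z0) < rho).
  { replace (z0 + RtoC (rho / 2) - z0)%C with (RtoC (rho / 2)) by ring.
    rewrite Cmod_R, Rabs_pos_eq; lra. }
  apply H, is_pseries_C_iff in Hz as [H1 H2].
  replace (z0 + RtoC (rho / 2) - z0)%C with (RtoC (rho / 2)) in H1, H2 by ring.
  apply is_series_term_bounded in H1 as [M1 HM1], H2 as [M2 HM2].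
  exists (M1 + M2). split; [lra|split].
  - intros n.
    replace (Cmod (a n) * (rho / 2) ^ n) with (Cmod (RtoC (rho / 2) ^ n * a n)%C).
    + generalize (Cmod_le_Re_Im (RtoC (rho / 2) ^ n * a n)%C) (HM1 n) (HM2 n); lra.
    + rewrite Cmod_mult, Cmod_pow, Cmod_R, Rabs_pos_eq by lra; ring.
  - intros z Hz; apply H; lra.
Qed.

Lemma power_term_le (a : nat -> C) (w : C) (rho M : R) (n : nat) :
  0 < rho -> Cmod (a n) * rho ^ n <= M ->
  Cmod (w ^ n * a n) <= M * (Cmod w / rho) ^ n.
Proof.
  intros Hr H. rewrite Cmod_mult, Cmod_pow.
  unfold Rdiv; rewrite Rpow_mult_distr, pow_inv.
  assert (0 < rho ^ n) by (apply pow_lt; exact Hr).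
  assert (0 <= Cmod w ^ n) by (apply pow_le, Cmod_ge_0).
  apply Rle_trans with (Cmod (a n) * rho ^ n * (Cmod w ^ n * / rho ^ n)).
  - right; field; lra.
  - apply Rmult_le_compat_r; [|exact H].
    apply Rmult_le_pos; [assumption|left; apply Rinv_0_lt_compat; assumption].
Qed.

(** Comparison with the geometric series of ratio |w| / rho.  The map [p] stands for
    the real or the imaginary part, so that real series theorems apply. *)
Lemma power_terms_summable (a : nat -> C) (w : C) (rho M : R) (p : C -> R) :
  (forall z, Rabs (p z) <= Cmod z) ->
  0 < rho -> (forall n, Cmod (a n) * rho ^ n <= M) -> Cmod w < rho ->
  ex_series (fun n => Rabs (p (w ^ n * a n)%C)).
Proof.
  intros Hp Hr HM Hw.
  apply (ex_series_le (K := R_AbsRing) (V := R_CompleteNormedModule) _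
    (fun n => M * (Cmod w / rho) ^ n)).
  - intros n. change (Rabs (Rabs (p (w ^ n * a n)%C)) <= M * (Cmod w / rho) ^ n).
    rewrite Rabs_Rabsolu. eapply Rle_trans; [apply Hp|].
    apply power_term_le; auto.
  - apply (ex_series_scal (K := R_AbsRing) (V := R_NormedModule) M).
    apply ex_series_geom. rewrite Rabs_pos_eq.
    + apply Rmult_lt_reg_r with rho; [lra|]. unfold Rdiv.
      rewrite Rmult_assoc, Rinv_l by lra. lra.
    + apply Rmult_le_pos; [apply Cmod_ge_0|left; apply Rinv_0_lt_compat; lra].
Qed.

Lemma power_sum_part_bound (a : nat -> C) (w : C) (rho M l : R) (p : C -> R) :
  (forall z, Rabs (p z) <= Cmod z) ->
  0 < rho -> (forall n, Cmod (a n) * rho ^ n <= M) -> 2 * Cmod w <= rho ->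
  is_series (fun n => p (w ^ n * a n)%C) l -> Rabs l <= 2 * M.
Proof.
  intros Hp Hr HM Hw Hl.
  assert (Hsum : ex_series (fun n => Rabs (p (w ^ n * a n)%C))).
  { apply (power_terms_summable a w rho M); auto. generalize (Cmod_ge_0 w); lra. }
  assert (HM0 : 0 <= M).
  { eapply Rle_trans; [|apply (HM O)]. rewrite pow_O, Rmult_1_r; apply Cmod_ge_0. }
  assert (G : is_series (fun n => M * (/ 2) ^ n) (2 * M)).
  { replace (2 * M) with (M * / (1 - / 2)) by field.
    apply (is_series_scal (K := R_AbsRing) (V := R_NormedModule) M).
    apply is_series_geom. rewrite Rabs_pos_eq; lra. }
  rewrite <- (is_series_unique _ _ Hl), <- (is_series_unique _ _ G).
  eapply Rle_trans; [apply Series_Rabs, Hsum|].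
  apply Series_le; [|exists (2 * M); exact G].
  intros n; split; [apply Rabs_pos|].
  eapply Rle_trans; [apply Hp|].
  eapply Rle_trans; [apply power_term_le; eauto|].
  apply Rmult_le_compat_l; [exact HM0|].
  apply pow_incr; split.
  - apply Rmult_le_pos; [apply Cmod_ge_0|left; apply Rinv_0_lt_compat; lra].
  - apply Rmult_le_reg_r with rho; [lra|]. unfold Rdiv.
      rewrite Rmult_assoc, Rinv_l by lra. lra.
Qed.

(** For 2 |w| <= rho each of the real and imaginary parts is dominated by a geometric
    series of ratio 1/2 and sum 2M. *)
Lemma power_sum_bound (a : nat -> C) (w l : C) (rho M : R) :
  0 < rho -> (forall n, Cmod (a n) * rho ^ n <= M) -> 2 * Cmod w <= rho ->
  is_pseries_C a w l -> Cmod l <= 4 * M.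
Proof.
  intros Hr HM Hw H. apply is_pseries_C_iff in H as [H1 H2].
  eapply (power_sum_part_bound a w rho M) in H1; try eassumption; [|apply Rabs_Re_le_Cmod].
  eapply (power_sum_part_bound a w rho M) in H2; try eassumption; [|apply Rabs_Im_le_Cmod].
  generalize (Cmod_le_Re_Im l); lra.
Qed.

(** Dividing out a factor z - z0: this is what reduces the order of a zero. *)
Lemma expansion_shift (f : C -> C) (z0 : C) (a : nat -> C) (rho M : R) :
  power_expansion f z0 a rho M ->
  forall z, z <> z0 -> Cmod (z - z0) < rho ->
  is_pseries_C
    (fun n => a (S n)) (z - z0)%C ((f z - a O) / (z - z0))%C.
Proof.
  intros (Hr & HM & H) z Hz Hzr.
  assert (Hz0 : (z - z0)%C <> RtoC 0).
  { intros E; apply Hz. replace z with ((z - z0) + z0)%C by ring. rewrite E; ring. }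
  generalize (is_pseries_decr_1 (K := C_AbsRing) (V := C_NormedModule)
    a (z - z0)%C (/ (z - z0))%C (f z)); intros D.
  replace ((f z - a O) / (z - z0))%C
    with (@scal C_AbsRing C_NormedModule (/ (z - z0))%C (plus (f z) (opp (a O)))).
  - apply D; [|auto]. change (/ (z - z0) * (z - z0) = RtoC 1)%C. apply Cinv_l; exact Hz0.
  - change (/ (z - z0) * (f z + - a O) = (f z - a O) / (z - z0))%C. field; exact Hz0.
Qed.

Lemma expansion_shift_bound (f : C -> C) (z0 : C) (a : nat -> C) (rho M : R) :
  power_expansion f z0 a rho M -> forall n, Cmod (a (S n)) * rho ^ n <= M / rho.
Proof.
  intros (Hr & HM & _) n. specialize (HM (S n)); simpl in HM.
  apply Rmult_le_reg_r with rho; [exact Hr|].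
  replace (M / rho * rho) with M by (field; lra).
  eapply Rle_trans; [|exact HM]. right; ring.
Qed.

Lemma expansion_coef0 (f : C -> C) (z0 : C) (a : nat -> C) (rho M : R) :
  power_expansion f z0 a rho M -> f z0 = a O.
Proof.
  intros (Hr & HM & H).
  assert (H0 : Cmod (z0 - z0) < rho).
  { replace (z0 - z0)%C with (RtoC 0) by ring. rewrite Cmod_0; exact Hr. }
  apply H in H0. replace (z0 - z0)%C with (RtoC 0) in H0 by ring.
  generalize (is_pseries_0 (K := C_AbsRing) (V := C_NormedModule) a); intros H1.
  exact (filterlim_locally_unique (V := C_NormedModule) _ _ _ H0 H1).
Qed.

Lemma expansion_lipschitz (f : C -> C) (z0 : C) (a : nat -> C) (rho M : R) :
  power_expansion f z0 a rho M ->
  forall z, 2 * Cmod (z - z0) <= rho ->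
  Cmod (f z - a O) <= 4 * (M / rho) * Cmod (z - z0).
Proof.
  intros Hf z Hz.
  destruct (Ceq_dec z z0) as [->|Hne].
  - rewrite (expansion_coef0 _ _ _ _ _ Hf).
    replace (a O - a O)%C with (RtoC 0) by ring.
    replace (z0 - z0)%C with (RtoC 0) by ring. rewrite Cmod_0; lra.
  - assert (Hr := proj1 Hf).
    assert (Hz0 : (z - z0)%C <> RtoC 0).
    { intros E; apply Hne. replace z with ((z - z0) + z0)%C by ring. rewrite E; ring. }
    assert (Hpos := proj1 (Cmod_gt_0 _) Hz0).
    assert (Hs := expansion_shift _ _ _ _ _ Hf z Hne ltac:(lra)).
    apply (power_sum_bound _ _ _ rho (M / rho)) in Hs; try lra.
    + unfold Cdiv in Hs. rewrite Cmod_mult, Cmod_inv in Hs by exact Hz0.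
      apply Rmult_le_reg_r with (/ Cmod (z - z0)).
      * apply Rinv_0_lt_compat; exact Hpos.
      * rewrite (Rmult_assoc _ (Cmod _)), Rinv_r, Rmult_1_r by lra. exact Hs.
    + exact (expansion_shift_bound _ _ _ _ _ Hf).
Qed.

Lemma analytic_at_continuous (f : C -> C) (z0 : C) :
  analytic_at f z0 -> continuous f z0.
Proof.
  intros H. apply analytic_at_expansion in H as (a & rho & M & Hf).
  intros A HA. apply locally_Cmod in HA as (e & He & HA).
  apply locally_Cmod.
  assert (Hr := proj1 Hf).
  assert (HK : 0 <= 4 * (M / rho)).
  { assert (0 <= M).
    { eapply Rle_trans; [|apply (proj1 (proj2 Hf) O)].
      rewrite pow_O, Rmult_1_r; apply Cmod_ge_0. }
    assert (0 <= M / rho); [|lra].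
    apply Rmult_le_pos; [lra|left; apply Rinv_0_lt_compat; lra]. }
  set (K := 4 * (M / rho)) in *.
  exists (Rmin (rho / 2) (e / (K + 1))). split.
  { apply Rmin_glb_lt; [lra|]. apply Rdiv_lt_0_compat; lra. }
  intros z Hz. apply HA.
  assert (H1 : Cmod (z - z0) < rho / 2) by (eapply Rlt_le_trans; [exact Hz|apply Rmin_l]).
  assert (H2 : Cmod (z - z0) < e / (K + 1)) by (eapply Rlt_le_trans; [exact Hz|apply Rmin_r]).
  rewrite (expansion_coef0 _ _ _ _ _ Hf).
  eapply Rle_lt_trans; [apply (expansion_lipschitz _ _ _ _ _ Hf); lra|].
  fold K. apply Rle_lt_trans with ((K + 1) * Cmod (z - z0)).
  - generalize (Cmod_ge_0 (z - z0)); nra.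
  - apply Rlt_le_trans with ((K + 1) * (e / (K + 1))).
    + apply Rmult_lt_compat_l; lra.
    + right; field; lra.
Qed.

(** If the constant term is nonzero, continuity suffices; otherwise f / (z - z0) has the
    same zeros off z0 and a nonzero coefficient of smaller index. *)
Lemma expansion_nonzero_coef (n : nat) :
  forall (f : C -> C) (z0 : C) (a : nat -> C) (rho M : R),
  power_expansion f z0 a rho M -> a n <> RtoC 0 ->
  exists r, 0 < r /\ forall z, z <> z0 -> Cmod (z - z0) < r -> f z <> RtoC 0.
Proof.
  assert (Base : forall (f : C -> C) (z0 : C) (a : nat -> C) (rho M : R),
    power_expansion f z0 a rho M -> a O <> RtoC 0 ->
    exists r, 0 < r /\ forall z, z <> z0 -> Cmod (z - z0) < r -> f z <> RtoC 0).
  { intros f z0 a rho M Hf Ha.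
    assert (Hc : continuous f z0).
    { apply analytic_at_continuous. exists a. apply locally_Cmod.
      exists rho; split; apply Hf. }
    assert (Hpos : 0 < Cmod (a O)) by (apply Cmod_gt_0; exact Ha).
    assert (L : locally (f z0) (fun y : C => y <> RtoC 0)).
    { apply locally_Cmod. exists (Cmod (a O)); split; [exact Hpos|].
      rewrite (expansion_coef0 _ _ _ _ _ Hf). intros y Hy ->.
      replace (RtoC 0 - a O)%C with (- a O)%C in Hy by ring.
      rewrite Cmod_opp in Hy; lra. }
    apply Hc, locally_Cmod in L as (r & Hr & L).
    exists r; split; [exact Hr|]. intros z _ Hz; apply L, Hz. }
  induction n as [|n IH]; intros f z0 a rho M Hf Ha.
  - exact (Base f z0 a rho M Hf Ha).
  - destruct (Ceq_dec (a O) (RtoC 0)) as [E|N]; [|exact (Base f z0 a rho M Hf N)].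
    (* [h] is f / (z - z0), with the value that continues it at [z0]. *)
    set (h := fun z => if Ceq_dec z z0 then a 1%nat else ((f z - a O) / (z - z0))%C).
    destruct (IH h z0 (fun n => a (S n)) rho (M / rho)) as (r & Hr & H).
    + assert (Hr := proj1 Hf). split; [exact Hr|split].
      * exact (expansion_shift_bound _ _ _ _ _ Hf).
      * intros z Hz. unfold h. destruct (Ceq_dec z z0) as [->|Hne].
        -- replace (z0 - z0)%C with (RtoC 0) by ring.
           apply (is_pseries_0 (K := C_AbsRing) (V := C_NormedModule) (fun n => a (S n))).
        -- apply (expansion_shift f z0 a rho M); assumption.
    + exact Ha.
    + exists r; split; [exact Hr|]. intros z Hne Hz Hfz.
      apply (H z Hne Hz). unfold h. destruct (Ceq_dec z z0); [contradiction|].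
      rewrite Hfz, E. unfold Cdiv. ring.
Qed.

Lemma analytic_zero_or_isolated (f : C -> C) (z0 : C) :
  analytic_at f z0 ->
  locally z0 (fun z => f z = RtoC 0) \/
  exists r, 0 < r /\ forall z, z <> z0 -> Cmod (z - z0) < r -> f z <> RtoC 0.
Proof.
  intros H. apply analytic_at_expansion in H as (a & rho & M & Hf).
  destruct (classic (exists n, a n <> RtoC 0)) as [[n Hn]|Hall].
  - right. exact (expansion_nonzero_coef n f z0 a rho M Hf Hn).
  - left. apply locally_Cmod. exists rho. split; [apply Hf|].
    intros z Hz. apply Hf, is_pseries_C_iff in Hz as [H1 H2].
    assert (Z : forall n, a n = RtoC 0).
    { intros n. apply NNPP. intros Hn; apply Hall; exists n; exact Hn. }
    assert (Z0 : is_series (fun _ : nat => 0) 0).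
    { apply (filterlim_ext (fun _ : nat => 0)); [|apply filterlim_const].
      intros n. rewrite sum_n_const. symmetry; apply Rmult_0_r. }
    apply injective_projections.
    + change (Re (f z) = 0).
      rewrite <- (is_series_unique _ _ H1), <- (is_series_unique _ _ Z0).
      apply Series_ext. intros n. rewrite Z, Cmult_0_r; reflexivity.
    + change (Im (f z) = 0).
      rewrite <- (is_series_unique _ _ H2), <- (is_series_unique _ _ Z0).
      apply Series_ext. intros n. rewrite Z, Cmult_0_r; reflexivity.
Qed.

(** * Algebra of analytic functions *)

Lemma analytic_at_affine (b c : C) (z0 : C) : analytic_at (fun z => b * z + c)%C z0.
Proof.
  exists (fun n => match n with O => (b * z0 + c)%C | 1%nat => b | _ => RtoC 0 end).
  apply filter_forall. intros z.
  assert (G : forall u : nat -> R, (forall n, u (S (S n)) = 0) -> is_series u (u O + u 1%nat)).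
  { intros u Hu. apply (filterlim_ext_loc (fun _ : nat => u O + u 1%nat));
      [|apply filterlim_const].
    exists 1%nat. intros n Hn. destruct n as [|n]; [lia|]. clear Hn.
    induction n as [|n IH].
    - rewrite sum_Sn, sum_O. reflexivity.
    - rewrite sum_Sn, <- IH, Hu. symmetry; apply Rplus_0_r. }
  apply is_pseries_C_iff; split.
  - eapply eq_ind_r; [apply G|].
    + intros n; rewrite Cmult_0_r; reflexivity.
    + unfold Re; simpl; ring.
  - eapply eq_ind_r; [apply G|].
    + intros n; rewrite Cmult_0_r; reflexivity.
    + unfold Im; simpl; ring.
Qed.

Lemma analytic_at_const (b z0 : C) : analytic_at (fun _ => b) z0.
Proof.
  destruct (analytic_at_affine (RtoC 0) b z0) as [a Ha]. exists a.
  revert Ha; apply filter_imp. intros z.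
  replace (0 * z + b)%C with b by (apply injective_projections; simpl; ring). auto.
Qed.

Lemma analytic_at_id (z0 : C) : analytic_at (fun z => z) z0.
Proof.
  destruct (analytic_at_affine (RtoC 1) (RtoC 0) z0) as [a Ha]. exists a.
  revert Ha; apply filter_imp. intros z.
  replace (1 * z + 0)%C with z by (apply injective_projections; simpl; ring). auto.
Qed.

Lemma analytic_at_plus (f g : C -> C) (z0 : C) :
  analytic_at f z0 -> analytic_at g z0 -> analytic_at (fun z => f z + g z)%C z0.
Proof.
  intros [a Ha] [b Hb]. exists (fun n => a n + b n)%C.
  generalize (filter_and _ _ Ha Hb). apply filter_imp. intros z [H1 H2].
  exact (is_pseries_plus (K := C_AbsRing) (V := C_NormedModule) _ _ _ _ _ H1 H2).
Qed.

(** The Cauchy product.  Its real and imaginary parts are combinations of the four real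
    Cauchy products of the parts of the factors, all of them absolutely convergent. *)
Lemma analytic_at_mult (f g : C -> C) (z0 : C) :
  analytic_at f z0 -> analytic_at g z0 -> analytic_at (fun z => f z * g z)%C z0.
Proof.
  intros Hf Hg.
  apply analytic_at_expansion in Hf as (a & r1 & M1 & R1 & B1 & S1).
  apply analytic_at_expansion in Hg as (b & r2 & M2 & R2 & B2 & S2).
  (* [cauchy n k] is the partial sum, up to [k], of the [n]-th Cauchy coefficient. *)
  set (cauchy := fun n => (fix s (k : nat) : C :=
     match k with O => a O * b n | S j => s j + a (S j) * b (n - S j)%nat end)%C).
  exists (fun n => cauchy n n).
  apply locally_Cmod. exists (Rmin r1 r2). split; [apply Rmin_glb_lt; assumption|].
  intros z Hz.
  assert (Hz1 : Cmod (z - z0) < r1) by (eapply Rlt_le_trans; [exact Hz|apply Rmin_l]).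
  assert (Hz2 : Cmod (z - z0) < r2) by (eapply Rlt_le_trans; [exact Hz|apply Rmin_r]).
  specialize (S1 z Hz1). specialize (S2 z Hz2).
  set (w := (z - z0)%C) in *.
  apply is_pseries_C_iff in S1 as [S1r S1i]. apply is_pseries_C_iff in S2 as [S2r S2i].
  assert (A1r := power_terms_summable a w r1 M1 Re Rabs_Re_le_Cmod R1 B1 Hz1).
  assert (A1i := power_terms_summable a w r1 M1 Im Rabs_Im_le_Cmod R1 B1 Hz1).
  assert (A2r := power_terms_summable b w r2 M2 Re Rabs_Re_le_Cmod R2 B2 Hz2).
  assert (A2i := power_terms_summable b w r2 M2 Im Rabs_Im_le_Cmod R2 B2 Hz2).
  assert (Prr := is_series_mult _ _ _ _ S1r S2r A1r A2r).
  assert (Pii := is_series_mult _ _ _ _ S1i S2i A1i A2i).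
  assert (Pri := is_series_mult _ _ _ _ S1r S2i A1r A2i).
  assert (Pir := is_series_mult _ _ _ _ S1i S2r A1i A2r).
  assert (K : forall n k, (k <= n)%nat ->
    (w ^ n * cauchy n k)%C =
    (sum_f_R0 (fun k => Re (w ^ k * a k)%C * Re (w ^ (n - k) * b (n - k)%nat)%C) k
     - sum_f_R0 (fun k => Im (w ^ k * a k)%C * Im (w ^ (n - k) * b (n - k)%nat)%C) k,
     sum_f_R0 (fun k => Re (w ^ k * a k)%C * Im (w ^ (n - k) * b (n - k)%nat)%C) k
     + sum_f_R0 (fun k => Im (w ^ k * a k)%C * Re (w ^ (n - k) * b (n - k)%nat)%C) k)).
  { intros n k.
    assert (T : forall k, (k <= n)%nat -> (w ^ n * (a k * b (n - k)%nat)
       = (w ^ k * a k) * (w ^ (n - k) * b (n - k)%nat))%C).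
    { intros j Hj. replace n with (j + (n - j))%nat at 1 by lia. rewrite Cpow_add_r; ring. }
    induction k as [|k IH]; intros Hk.
    - simpl cauchy. generalize (T O Hk). rewrite Nat.sub_0_r. intros ->.
      simpl sum_f_R0. rewrite Nat.sub_0_r.
      apply injective_projections; unfold Re, Im; simpl; ring.
    - change (cauchy n (S k)) with (cauchy n k + a (S k) * b (n - S k)%nat)%C.
      rewrite Cmult_plus_distr_l, IH, T by lia.
      rewrite !tech5.
      apply injective_projections; unfold Re, Im; simpl; ring. }
  apply is_pseries_C_iff; split.
  - apply (is_series_ext (fun n =>
     sum_f_R0 (fun k => Re (w ^ k * a k)%C * Re (w ^ (n - k) * b (n - k)%nat)%C) n
     - sum_f_R0 (fun k => Im (w ^ k * a k)%C * Im (w ^ (n - k) * b (n - k)%nat)%C) n)).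
    + intros n. rewrite (K n n (le_n n)). reflexivity.
    + exact (is_series_minus (K := R_AbsRing) (V := R_NormedModule) _ _ _ _ Prr Pii).
  - apply (is_series_ext (fun n =>
     sum_f_R0 (fun k => Re (w ^ k * a k)%C * Im (w ^ (n - k) * b (n - k)%nat)%C) n
     + sum_f_R0 (fun k => Im (w ^ k * a k)%C * Re (w ^ (n - k) * b (n - k)%nat)%C) n)).
    + intros n. rewrite (K n n (le_n n)). reflexivity.
    + exact (is_series_plus (K := R_AbsRing) (V := R_NormedModule) _ _ _ _ Pri Pir).
Qed.

Lemma analytic_at_opp (f : C -> C) (z0 : C) :
  analytic_at f z0 -> analytic_at (fun z => - f z)%C z0.
Proof.
  intros Hf.
  destruct (analytic_at_mult _ _ z0 (analytic_at_const (RtoC (-1)) z0) Hf) as [a Ha].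
  exists a. revert Ha; apply filter_imp. intros z.
  replace (RtoC (-1) * f z)%C with (- f z)%C; [auto|].
  apply injective_projections; simpl; ring.
Qed.

(** * Analytic continuation along a path *)

Lemma within_interval_iff (a b u : R) (P : R -> Prop) :
  within (fun v => a <= v <= b) (locally u) P <->
  exists e, 0 < e /\ forall v, a <= v <= b -> Rabs (v - u) < e -> P v.
Proof.
  split.
  - intros [e He]. exists e; split; [apply cond_pos|].
    intros v Hv Hd. apply He; assumption.
  - intros (e & He & H). exists (mkposreal e He).
    intros v Hv Hd. apply H; assumption.
Qed.

(** Connectedness of an interval, as an induction principle: a property that holds at
    one end and is both open and closed holds throughout. *)
Lemma interval_connected (a b : R) (P : R -> Prop) :
  P a ->
  (forall u, a <= u <= b -> P u -> within (fun v => a <= v <= b) (locally u) P) ->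
  (forall u, a <= u <= b -> ~ P u ->
     within (fun v => a <= v <= b) (locally u) (fun v => ~ P v)) ->
  forall u, a <= u <= b -> P u.
Proof.
  intros Pa Op Cl u0 Hu0.
  set (E := fun u => a <= u <= u0 /\ forall v, a <= v <= u -> P v).
  destruct (completeness E) as [m [Hub Hlub]].
  { exists u0. intros u [Hu _]; lra. }
  { exists a. split; [lra|]. intros v Hv. replace v with a by lra. exact Pa. }
  assert (Ham : a <= m).
  { apply Hub. split; [lra|]. intros v Hv. replace v with a by lra. exact Pa. }
  assert (Hmu : m <= u0) by (apply Hlub; intros u [Hu _]; lra).
  assert (Below : forall v, a <= v < m -> P v).
  { intros v Hv. apply NNPP; intros N.
    assert (Hvm : is_upper_bound E v).
    { intros u [Hu Hall]. destruct (Rle_lt_dec u v) as [|Hlt]; [assumption|].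
      exfalso; apply N, Hall; lra. }
    apply Hlub in Hvm; lra. }
  assert (Pm : P m).
  { apply NNPP; intros N.
    destruct (proj1 (within_interval_iff _ _ _ _) (Cl m ltac:(lra) N)) as (e & He & H).
    destruct (Rle_lt_or_eq_dec _ _ Ham) as [Hlt|Heq]; [|subst m; contradiction].
    apply (H (Rmax a (m - e / 2))).
    - split; [apply Rmax_l|]. apply Rmax_lub; lra.
    - apply Rabs_def1; [apply Rle_lt_trans with 0; [|lra]|].
      + assert (Rmax a (m - e / 2) <= m) by (apply Rmax_lub; lra). lra.
      + generalize (Rmax_r a (m - e / 2)); lra.
    - apply Below. split; [apply Rmax_l|]. apply Rmax_lub_lt; lra. }
  destruct (Rle_lt_or_eq_dec _ _ Hmu) as [Hlt|Heq]; [|subst u0; exact Pm].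
  exfalso.
  destruct (proj1 (within_interval_iff _ _ _ _) (Op m ltac:(lra) Pm)) as (e & He & H).
  assert (HE : E (Rmin u0 (m + e / 2))).
  { assert (Hm : m <= Rmin u0 (m + e / 2)) by (apply Rmin_glb; lra).
    split; [generalize (Rmin_l u0 (m + e / 2)); lra|].
    intros v Hv. destruct (Rlt_le_dec v m) as [|Hge]; [apply Below; lra|].
    generalize (Rmin_l u0 (m + e / 2)) (Rmin_r u0 (m + e / 2)); intros.
    apply H; [lra|]. rewrite Rabs_pos_eq; lra. }
  apply Hub in HE.
  assert (m < Rmin u0 (m + e / 2)) by (apply Rmin_glb_lt; lra). lra.
Qed.

(** A continuation identifies the nearby germs with [F u], so a property of the pair
    (value, point) that holds for [F u] near [c u] passes to the nearby parameters. *)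
Lemma continuation_property_open (D : R -> Prop) (c : R -> C) (F : R -> C -> C)
  (u : R) (A : C -> C -> Prop) :
  continuous c u -> continuation_along D c F -> D u ->
  locally (c u) (fun z => A (F u z) z) ->
  within D (locally u) (fun v => A (F v (c v)) (c v)).
Proof.
  intros Hc HF Hu HA.
  assert (Hv : locally u (fun v => A (F u (c v)) (c v))) by exact (Hc _ HA).
  apply (@filter_le_within R (locally u) _ D) in Hv.
  generalize (filter_and (F := within D (locally u)) _ _ (proj2 (HF u Hu)) Hv).
  apply filter_imp. intros v [H1 H2].
  rewrite (locally_singleton _ _ H1). exact H2.
Qed.

(** Permanence of functional equations.  Openness is immediate.  If the equation fails
    near [c u], the analytic function z |-> N (F u z) z has at most the zero [c u] near that
    point, so it cannot vanish on a disc around a nearby [c v]; thus the failure is open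
    as well. *)
Lemma continuation_equation (N : C -> C -> C) (c : R -> C) (F : R -> C -> C) (a b : R) :
  (forall f z, analytic_at f z -> analytic_at (fun w => N (f w) w) z) ->
  (forall u, continuous c u) ->
  continuation_along (fun u => a <= u <= b) c F ->
  locally (c a) (fun z => N (F a z) z = RtoC 0) ->
  forall u, a <= u <= b -> locally (c u) (fun z => N (F u z) z = RtoC 0).
Proof.
  intros HN Hc HF Ha.
  apply interval_connected; [exact Ha| |].
  - intros u Hu H0.
    destruct (HF u Hu) as [_ Hg].
    assert (Hl := Hc u _ (locally_locally _ _ H0)).
    apply (@filter_le_within R (locally u) _ (fun v => a <= v <= b)) in Hl.
    generalize (filter_and (F := within _ (locally u)) _ _ Hg Hl).
    apply filter_imp. intros v [H1 H2].
    generalize (filter_and _ _ H1 H2). apply filter_imp.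
    intros z [E1 E2]. rewrite E1; exact E2.
  - intros u Hu H0.
    destruct (HF u Hu) as [Han Hg].
    destruct (analytic_zero_or_isolated _ _ (HN _ _ Han))
      as [|(r & Hr & Hiso)]; [contradiction|].
    assert (L : locally (c u) (fun z => Cmod (z - c u) < r)).
    { apply locally_Cmod. exists r; split; [exact Hr|]; auto. }
    apply (Hc u), (@filter_le_within R (locally u) _ (fun v => a <= v <= b)) in L.
    generalize (filter_and (F := within _ (locally u)) _ _ Hg L).
    apply filter_imp. intros v [H1 H2] Hv.
    generalize (filter_and _ _ H1 Hv). intros H3.
    apply locally_Cmod in H3 as (e & He & H3).
    (* The equation holds on a whole disc around [c v], which contains points other
       than the only possible zero [c u]. *)
    assert (Hz : exists z, z <> c u /\ Cmod (z - c u) < r /\ Cmod (z - c v) < e).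
    { destruct (Ceq_dec (c v) (c u)) as [E|Ne].
      - set (h := Rmin (r / 2) (e / 2)).
        assert (Hh : 0 < h) by (apply Rmin_glb_lt; lra).
        assert (Hm : Cmod (c u + RtoC h - c u) = h).
        { replace (c u + RtoC h - c u)%C with (RtoC h) by ring.
          rewrite Cmod_R; apply Rabs_pos_eq; lra. }
        exists (c u + RtoC h)%C. rewrite E, Hm. split; [|split].
        + intros E'. rewrite E' in Hm. replace (c u - c u)%C with (RtoC 0) in Hm by ring.
          rewrite Cmod_0 in Hm; lra.
        + generalize (Rmin_l (r / 2) (e / 2)); unfold h; lra.
        + generalize (Rmin_r (r / 2) (e / 2)); unfold h; lra.
      - exists (c v). split; [exact Ne|split; [exact H2|]].
        replace (c v - c v)%C with (RtoC 0) by ring. rewrite Cmod_0; exact He. }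
    destruct Hz as (z & Hz1 & Hz2 & Hz3).
    destruct (H3 z Hz3) as [E1 E2].
    apply (Hiso z Hz1 Hz2). rewrite <- E1. exact E2.
Qed.

(** * Chebyshev polynomials and the sides of the separating line *)

Lemma chebyshev_2 (x : C) : chebyshev 2 x = (2 * x * x - 1)%C.
Proof. reflexivity. Qed.

Lemma chebyshev_3 (x : C) : chebyshev 3 x = (x * (4 * x * x - 3))%C.
Proof. simpl; ring. Qed.

(** T_6 = T_2 o T_3. *)
Lemma chebyshev_6_of_chebyshev_3 (x : C) :
  chebyshev 6 x = (2 * chebyshev 3 x * chebyshev 3 x - 1)%C.
Proof. simpl; ring. Qed.

(** T_6 = T_3 o T_2. *)
Lemma chebyshev_6_of_chebyshev_2 (x : C) :
  let w := chebyshev 2 x in chebyshev 6 x = (w * (4 * w * w - 3))%C.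
Proof. simpl; ring. Qed.

Lemma continuous_chebyshev (n : nat) (x : C) : continuous (chebyshev n) x.
Proof.
  enough (H : continuous (chebyshev n) x /\ continuous (chebyshev (S n)) x) by apply H.
  induction n as [|n [IH0 IH1]]; split.
  - apply continuous_const.
  - apply continuous_id.
  - exact IH1.
  - apply continuous_Cplus.
    + apply (continuous_Cmult (fun x => 2 * x)%C); [|exact IH1].
      apply continuous_Cmult; [apply continuous_const|apply continuous_id].
    + apply (continuous_ext (fun x => RtoC (-1) * chebyshev n x)%C).
      * intros y. change (RtoC (-1) * chebyshev n y = - chebyshev n y)%C.
        apply injective_projections; simpl; ring.
      * apply continuous_Cmult; [apply continuous_const|exact IH0].
Qed.

(** With d = 4x^2 - 3 one has Q(x) - 1/2 = d (1/2 + x) and (P(x) + 1) / 2 = (x d)^2, so the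
    difference is |d|^2 (|x + 1/2|^2 - |x|^2). *)
Lemma side_gap (x : C) :
  Cmod (chebyshev 2 x + chebyshev 3 x - 1 / 2) ^ 2 - Cmod ((1 + chebyshev 6 x) / 2)
  = Cmod (4 * x * x - 3) ^ 2 * (Re x + 1 / 4).
Proof.
  replace (chebyshev 2 x + chebyshev 3 x - 1 / 2)%C
    with ((4 * x * x - 3) * (1 / 2 + x))%C.
  2: { rewrite chebyshev_2, chebyshev_3. field. }
  replace ((1 + chebyshev 6 x) / 2)%C with ((4 * x * x - 3) * x * ((4 * x * x - 3) * x))%C.
  2: { rewrite chebyshev_6_of_chebyshev_3, chebyshev_3. field. }
  rewrite !Cmod_mult, Rpow_mult_distr.
  replace (Cmod (1 / 2 + x) ^ 2) with (Cmod x ^ 2 + (Re x + 1 / 4)).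
  - ring.
  - rewrite !Cmod_sqr. destruct x as [a b]. unfold Re, Im; simpl. field.
Qed.

(** For q = Q(x) and z = P(x) <> -1 this says, by [side_gap], that Re x < -1/4; being
    expressed by [q] and [z] only, it makes sense for a germ whose preimages are unknown. *)
Definition on_left_side (q z : C) : Prop :=
  Cmod (q - 1 / 2) ^ 2 < Cmod ((1 + z) / 2).

Definition on_right_side (q z : C) : Prop :=
  Cmod ((1 + z) / 2) < Cmod (q - 1 / 2) ^ 2.

Lemma side_gap_factor_pos (x : C) :
  chebyshev 6 x <> RtoC (-1) -> 0 < Cmod (4 * x * x - 3) ^ 2.
Proof.
  intros H. apply pow_lt, Cmod_gt_0. intros E. apply H.
  rewrite chebyshev_6_of_chebyshev_3, chebyshev_3, E.
  apply injective_projections; simpl; ring.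
Qed.

Lemma side_left (x : C) : chebyshev 6 x <> RtoC (-1) -> Re x < -1/4 ->
  on_left_side (chebyshev 2 x + chebyshev 3 x) (chebyshev 6 x).
Proof.
  intros H Hx. unfold on_left_side.
  generalize (side_gap_factor_pos x H) (side_gap x). nra.
Qed.

Lemma side_right (x : C) : chebyshev 6 x <> RtoC (-1) -> -1/4 < Re x ->
  on_right_side (chebyshev 2 x + chebyshev 3 x) (chebyshev 6 x).
Proof.
  intros H Hx. unfold on_right_side.
  generalize (side_gap_factor_pos x H) (side_gap x). nra.
Qed.

(** On the line, |x| >= 1/4 and |4x^2 - 3| >= 11/4, so
    |P(x) + 1| = 2 |x|^2 |4x^2 - 3|^2 is at least 121/128. *)
Lemma separating_line (x : C) : Cmod (chebyshev 6 x - RtoC (-1)) < 1 / 2 -> Re x <> -1/4.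
Proof.
  intros H E.
  replace (chebyshev 6 x - RtoC (-1))%C
    with (2 * (x * x) * ((4 * x * x - 3) * (4 * x * x - 3)))%C in H.
  2: { rewrite chebyshev_6_of_chebyshev_3, chebyshev_3.
       apply injective_projections; simpl; ring. }
  rewrite !Cmod_mult, Cmod_R, Rabs_pos_eq in H by lra.
  replace (Cmod x * Cmod x) with (Cmod x ^ 2) in H by ring.
  replace (Cmod (4 * x * x - 3) * Cmod (4 * x * x - 3))
    with (Cmod (4 * x * x - 3) ^ 2) in H by ring.
  rewrite !Cmod_sqr in H. destruct x as [a b]. unfold Re, Im in *; simpl in *. subst a.
  ring_simplify in H.
  assert (0 <= b * b) by nra.
  assert (0 <= b ^ 2 * b ^2) by nra.
  nra.
Qed.

(** * The algebraic equation satisfied by the branches *)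

(** The resultant that eliminates x from q = Q(x), z = P(x).  With s = (1 + z) / 2, the
    value y = T_3(x) satisfies y^2 = s, and substituting T_2(x) = q - y into T_3(T_2(x)) = z
    gives A = y B; squaring removes y. *)
Definition branch_equation (q z : C) : C :=
  let s := ((1 + z) / 2)%C in
  let A := (4 * q * q * q + 12 * q * s - 3 * q - 2 * s + 1)%C in
  let B := (12 * q * q + 4 * s - 3)%C in
  (A * A - s * B * B)%C.

Lemma branch_equation_of_preimage (x : C) :
  branch_equation (chebyshev 2 x + chebyshev 3 x) (chebyshev 6 x) = RtoC 0.
Proof.
  unfold branch_equation. rewrite chebyshev_6_of_chebyshev_3, chebyshev_2, chebyshev_3. field.
Qed.

(** A square root y of s and w = q - y satisfy (w + 1) (2w - 1)^2 = 2 y^2, that is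
    T_3(w) = T_2(y).  Then x = y / (2w - 1) has T_2(x) = w and T_3(x) = y; the denominator is
    nonzero because y is, which is where z <> -1 enters. *)
Lemma preimage_of_branch_equation (q z : C) :
  branch_equation q z = RtoC 0 -> z <> RtoC (-1) ->
  exists x, chebyshev 6 x = z /\ q = (chebyshev 2 x + chebyshev 3 x)%C.
Proof.
  intros H Hz. unfold branch_equation in H.
  set (s := ((1 + z) / 2)%C) in *.
  set (A := (4 * q * q * q + 12 * q * s - 3 * q - 2 * s + 1)%C) in *.
  set (B := (12 * q * q + 4 * s - 3)%C) in *.
  assert (Hzs : z = (2 * s - 1)%C) by (unfold s; field).
  assert (Hy : exists y, (y * y = s /\ A = y * B)%C).
  { destruct (Csqrt_exists s) as [y Hy].
    (* A^2 = s B^2 = (y B)^2; the sign of the root [y] is chosen so that A = y B. *)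
    assert (E : ((A - y * B) * (A + y * B) = 0)%C).
    { rewrite <- H, <- Hy. ring. }
    destruct (Ceq_dec (A - y * B) (RtoC 0)) as [E1|N1].
    - exists y; split; [exact Hy|].
      replace A with ((A - y * B) + y * B)%C by ring. rewrite E1; ring.
    - destruct (Ceq_dec (A + y * B) (RtoC 0)) as [E2|N2].
      + exists (- y)%C; split; [rewrite <- Hy; ring|].
        replace A with ((A + y * B) - y * B)%C by ring. rewrite E2; ring.
      + exfalso. exact (Cmult_neq_0 _ _ N1 N2 E). }
  destruct Hy as (y & Hy & HAB).
  set (w := (q - y)%C).
  assert (Hw : ((w + 1) * (2 * w - 1) * (2 * w - 1) = 2 * s)%C).
  { assert (E : ((w + 1) * (2 * w - 1) * (2 * w - 1) - 2 * s = A - y * B)%C).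
    { unfold A, B, w. rewrite <- Hy. ring. }
    replace ((w + 1) * (2 * w - 1) * (2 * w - 1))%C
      with ((w + 1) * (2 * w - 1) * (2 * w - 1) - 2 * s + 2 * s)%C by ring.
    rewrite E, HAB; ring. }
  assert (Hs : s <> RtoC 0).
  { intros E. apply Hz. rewrite Hzs, E.
    apply injective_projections; simpl; ring. }
  assert (Hd : (2 * w - 1)%C <> RtoC 0).
  { intros E. apply Hs. rewrite E in Hw.
    replace s with (/ 2 * (2 * s))%C by (field). rewrite <- Hw; ring. }
  exists (y / (2 * w - 1))%C. set (x := (y / (2 * w - 1))%C).
  assert (Hx : (x * (2 * w - 1) = y)%C) by (unfold x; field; exact Hd).
  assert (Hxx : (2 * x * x - 1 = w)%C).
  { unfold x.
    replace (2 * (y / (2 * w - 1)) * (y / (2 * w - 1)) - 1)%C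
      with (2 * (y * y) / ((2 * w - 1) * (2 * w - 1)) - 1)%C by (field; exact Hd).
    rewrite Hy, <- Hw. field; exact Hd. }
  assert (H3 : chebyshev 3 x = y).
  { rewrite chebyshev_3, <- Hx. rewrite <- Hxx. ring. }
  split.
  - rewrite chebyshev_6_of_chebyshev_3, H3, Hzs, <- Hy. ring.
  - rewrite H3, chebyshev_2, Hxx. unfold w; ring.
Qed.

Lemma analytic_at_branch_equation (f : C -> C) (z0 : C) :
  analytic_at f z0 -> analytic_at (fun z => branch_equation (f z) z) z0.
Proof.
  intros Hf. unfold branch_equation, Cminus, Cdiv.
  repeat lazymatch goal with
  | |- analytic_at (fun z => z) _ => apply analytic_at_id
  | |- analytic_at (fun z => f z) _ => exact Hf
  | |- analytic_at (fun _ => ?b) _ => apply analytic_at_const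
  | |- analytic_at (fun z => @?u z + @?v z)%C _ => apply (analytic_at_plus u v)
  | |- analytic_at (fun z => @?u z * @?v z)%C _ => apply (analytic_at_mult u v)
  | |- analytic_at (fun z => - @?u z)%C _ => apply (analytic_at_opp u)
  end.
Qed.

Lemma side_dichotomy (q z : C) :
  branch_equation q z = RtoC 0 ->
  Cmod (z - RtoC (-1)) < 1 / 2 -> z <> RtoC (-1) ->
  on_left_side q z \/ on_right_side q z.
Proof.
  intros H Hr Hz. destruct (preimage_of_branch_equation q z H Hz) as (x & <- & ->).
  generalize (separating_line x Hr); intros Hne.
  destruct (Rtotal_order (Re x) (-1/4)) as [Hx|[Hx|Hx]]; [|contradiction|].
  - left; exact (side_left x Hz Hx).
  - right; exact (side_right x Hz Hx).
Qed.

Lemma continuous_side_gap (f : C -> C) (z0 : C) :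
  continuous f z0 ->
  continuous (fun z => Cmod (f z - 1 / 2) ^ 2 - Cmod ((1 + z) / 2)) z0.
Proof.
  intros Hf.
  apply (continuous_minus (V := R_NormedModule)).
  - apply (continuous_ext (fun z => Cmod (f z - 1 / 2) * Cmod (f z - 1 / 2)));
      [intros z; simpl; ring|].
    apply (continuous_mult (K := R_AbsRing)); apply continuous_Cmod, continuous_Cplus;
      [exact Hf|apply continuous_const|exact Hf|apply continuous_const].
  - apply continuous_Cmod, continuous_Cmult; [|apply continuous_const].
    apply continuous_Cplus; [apply continuous_const|apply continuous_id].
Qed.

(** Each side is an open condition on the pair (value, point), and by [side_dichotomy] one
    of the two holds all along the path; connectedness of the interval concludes. *)
Lemma side_invariant (c : R -> C) (F : R -> C -> C) :
  (forall u, continuous c u) ->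
  (forall u, 0 <= u <= 1 -> Cmod (c u - RtoC (-1)) < 1 / 2 /\ c u <> RtoC (-1)) ->
  continuation_along (fun u => 0 <= u <= 1) c F ->
  locally (c 0) (fun z => branch_equation (F 0 z) z = RtoC 0) ->
  (on_left_side (F 0 (c 0)) (c 0) -> on_left_side (F 1 (c 1)) (c 1)) /\
  (on_right_side (F 0 (c 0)) (c 0) -> on_right_side (F 1 (c 1)) (c 1)).
Proof.
  intros Hc HU HF H0.
  assert (HN := continuation_equation branch_equation c F 0 1
                  analytic_at_branch_equation Hc HF H0).
  assert (HL : forall u, 0 <= u <= 1 -> on_left_side (F u (c u)) (c u) ->
    within (fun v => 0 <= v <= 1) (locally u) (fun v => on_left_side (F v (c v)) (c v))).
  { intros u Hu Hl.
    apply (continuation_property_open _ _ _ _ on_left_side (Hc u) HF Hu).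
    assert (Hf := continuous_side_gap _ _ (analytic_at_continuous _ _ (proj1 (HF u Hu)))).
    assert (L := Hf (fun y => y < 0) (open_lt 0 _ (Rlt_minus _ _ Hl))).
    unfold filtermap in L; revert L; apply filter_imp. intros z; apply Rminus_lt. }
  assert (HR : forall u, 0 <= u <= 1 -> on_right_side (F u (c u)) (c u) ->
    within (fun v => 0 <= v <= 1) (locally u) (fun v => on_right_side (F v (c v)) (c v))).
  { intros u Hu Hl.
    apply (continuation_property_open _ _ _ _ on_right_side (Hc u) HF Hu).
    assert (Hf := continuous_side_gap _ _ (analytic_at_continuous _ _ (proj1 (HF u Hu)))).
    assert (L := Hf (fun y => 0 < y) (open_gt 0 _ (proj1 (Rminus_lt_0 _ _) Hl))).
    unfold filtermap in L; revert L; apply filter_imp. intros z; apply Rminus_lt_0. }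
  assert (HD : forall u, 0 <= u <= 1 ->
    on_left_side (F u (c u)) (c u) \/ on_right_side (F u (c u)) (c u)).
  { intros u Hu. apply side_dichotomy; try apply HU; auto.
    apply (locally_singleton _ _ (HN u Hu)). }
  assert (Excl : forall q z, on_left_side q z -> on_right_side q z -> False).
  { intros q z H1 H2. exact (Rlt_asym _ _ H1 H2). }
  split; intros Hs.
  - apply (interval_connected 0 1 (fun u => on_left_side (F u (c u)) (c u))); auto; [|lra].
    intros u Hu N. destruct (HD u Hu) as [|Hr]; [contradiction|].
    generalize (HR u Hu Hr). apply filter_imp.
    intros v Hv Hl. exact (Excl _ _ Hl Hv).
  - apply (interval_connected 0 1 (fun u => on_right_side (F u (c u)) (c u))); auto; [|lra].
    intros u Hu N. destruct (HD u Hu) as [Hl|]; [|contradiction].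
    generalize (HL u Hu Hl). apply filter_imp.
    intros v Hv Hr. exact (Excl _ _ Hv Hr).
Qed.

(** The germs take the values Q(x) and Q(y) at the two ends, and the sides of these values
    are the sides of x and y.  For the two branches at -1 these are different. *)
Lemma obtained_within_same_side (x y : C) (f h : C -> C) :
  locally (chebyshev 6 x) (fun z => branch_equation (f z) z = RtoC 0) ->
  f (chebyshev 6 x) = (chebyshev 2 x + chebyshev 3 x)%C ->
  h (chebyshev 6 y) = (chebyshev 2 y + chebyshev 3 y)%C ->
  obtained_within (fun z => Cmod (z - RtoC (-1)) < 1 / 2 /\ z <> RtoC (-1))
    (chebyshev 6 x) f (chebyshev 6 y) h ->
  (Re x < -1/4 <-> Re y < -1/4).
Proof.
  intros Hf Hx Hy (c & F & Hc & c0 & c1 & HU & HF & G0 & G1).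
  assert (U0 := HU 0 ltac:(lra)). assert (U1 := HU 1 ltac:(lra)).
  rewrite c0 in U0; rewrite c1 in U1.
  assert (H0 : locally (c 0) (fun z => branch_equation (F 0 z) z = RtoC 0)).
  { rewrite c0. generalize (filter_and _ _ G0 Hf). apply filter_imp.
    intros z [E Hz]. rewrite E; exact Hz. }
  destruct (side_invariant c F Hc HU HF H0) as [SL SR].
  rewrite c0, c1, (locally_singleton _ _ G0), (locally_singleton _ _ G1), Hx, Hy in SL, SR.
  assert (Excl : forall q z, on_left_side q z -> on_right_side q z -> False).
  { intros q z H1 H2. exact (Rlt_asym _ _ H1 H2). }
  assert (Nx := separating_line x (proj1 U0)). assert (Ny := separating_line y (proj1 U1)).
  split; intros H; apply Rnot_le_lt; intros H'.
  - apply (Excl (chebyshev 2 y + chebyshev 3 y)%C (chebyshev 6 y));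
      [apply SL, side_left|apply side_right]; try apply U0; try apply U1; lra.
  - apply (Excl (chebyshev 2 y + chebyshev 3 y)%C (chebyshev 6 y));
      [apply side_left|apply SR, side_right]; try apply U0; try apply U1; lra.
Qed.

(** * Piecewise continuously differentiable paths *)

Lemma piecewise_C1_le (c : R -> C) (a b : R) : piecewise_C1 c a b -> a <= b.
Proof. induction 1; lra. Qed.

Lemma C1_path_is_derive (d : R -> C) : C1_path d ->
  forall u, is_derive_path d u (path_derive d u).
Proof.
  intros Hd u. destruct (Hd u) as (H1 & H2 & _).
  apply is_derive_C_iff; split; apply Derive_correct; assumption.
Qed.

Lemma C1_path_continuous (d : R -> C) : C1_path d -> forall u, continuous d u.
Proof.
  intros Hd u.
  apply (ex_derive_continuous (K := R_AbsRing) (V := C_R_NormedModule) d u).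
  exists (path_derive d u). apply C1_path_is_derive, Hd.
Qed.

Lemma piecewise_C1_continuous (c : R -> C) (a b : R) (A : C -> Prop) :
  piecewise_C1 c a b -> forall u, a <= u <= b -> locally (c u) A ->
  within (fun v => a <= v <= b) (locally u) (fun v => A (c v)).
Proof.
  intros Hc. induction Hc as [a b d Hab Hd Hcd|a m b H1 IH1 H2 IH2]; intros u Hu HA.
  - rewrite (Hcd u Hu) in HA.
    generalize (C1_path_continuous d Hd u _ HA). unfold filtermap, within.
    apply filter_imp.
    intros v Hv Dv. rewrite (Hcd v Dv). exact Hv.
  - apply piecewise_C1_le in H1, H2.
    assert (G1 : exists e, 0 < e /\ forall v, a <= v <= m -> Rabs (v - u) < e -> A (c v)).
    { destruct (Rle_lt_dec u m) as [Hum|Hum].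
      - apply within_interval_iff, IH1; [lra|exact HA].
      - exists (u - m). split; [lra|]. intros v Hv Hd.
        apply Rabs_def2 in Hd. lra. }
    assert (G2 : exists e, 0 < e /\ forall v, m <= v <= b -> Rabs (v - u) < e -> A (c v)).
    { destruct (Rle_lt_dec m u) as [Hum|Hum].
      - apply within_interval_iff, IH2; [lra|exact HA].
      - exists (m - u). split; [lra|]. intros v Hv Hd.
        apply Rabs_def2 in Hd. lra. }
    destruct G1 as (e1 & He1 & G1), G2 as (e2 & He2 & G2).
    apply within_interval_iff. exists (Rmin e1 e2). split; [apply Rmin_glb_lt; assumption|].
    intros v Hv Hd.
    generalize (Rmin_l e1 e2) (Rmin_r e1 e2); intros.
    destruct (Rle_lt_dec v m); [apply G1|apply G2]; lra.
Qed.

Lemma piecewise_C1_bounded (f : C -> C) (c : R -> C) (a b : R) :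
  (forall z, continuous f z) -> piecewise_C1 c a b ->
  exists B, forall u, a <= u <= b -> Cmod (f (c u)) <= B.
Proof.
  intros Hf Hc. induction Hc as [a b d Hab Hd Hcd|a m b H1 [B1 IH1] H2 [B2 IH2]].
  - destruct (continuous_ab_maj_consistent (fun u => Cmod (f (d u))) a b Hab) as [u0 [Hmax _]].
    { intros u _. apply continuous_Cmod.
      exact (continuous_comp d f u (C1_path_continuous d Hd u) (Hf (d u))). }
    exists (Cmod (f (d u0))). intros u Hu. rewrite Hcd by exact Hu. apply Hmax, Hu.
  - exists (Rmax B1 B2). intros u Hu. destruct (Rle_lt_dec u m).
    + eapply Rle_trans; [apply IH1; lra|apply Rmax_l].
    + eapply Rle_trans; [apply IH2; lra|apply Rmax_r].
Qed.

(** A piece of the curve whose image stays in the disc |z + 1| < 1/2 cannot cross the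
    separating line. *)
Lemma shift_side (Gam : R -> C) (a b : R) :
  (forall u A, a <= u <= b -> locally (Gam u) A ->
     within (fun v => a <= v <= b) (locally u) (fun v => A (Gam v))) ->
  (forall u, a <= u <= b -> Cmod (chebyshev 6 (Gam u) - RtoC (-1)) < 1 / 2) ->
  a <= b -> (Re (Gam a) < -1/4 <-> Re (Gam b) < -1/4).
Proof.
  intros Hc Hr Hab.
  assert (Op1 : forall u, a <= u <= b -> Re (Gam u) < -1/4 ->
    within (fun v => a <= v <= b) (locally u) (fun v => Re (Gam v) < -1/4)).
  { intros u Hu Hl. apply (Hc u (fun z => Re z < -1/4) Hu).
    assert (Hre : continuous Re (Gam u))
      by exact (proj1 (proj1 (continuous_C_iff (fun z : C => z) _) (continuous_id _))).
    exact (Hre (fun y => y < -1/4) (open_lt _ _ Hl)). }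
  assert (Op2 : forall u, a <= u <= b -> ~ Re (Gam u) < -1/4 ->
    within (fun v => a <= v <= b) (locally u) (fun v => ~ Re (Gam v) < -1/4)).
  { intros u Hu Hl. apply (Hc u (fun z => ~ Re z < -1/4) Hu).
    assert (Hgt : -1/4 < Re (Gam u)) by (generalize (separating_line _ (Hr u Hu)); lra).
    assert (Hre : continuous Re (Gam u))
      by exact (proj1 (proj1 (continuous_C_iff (fun z : C => z) _) (continuous_id _))).
    generalize (Hre (fun y => -1/4 < y) (open_gt _ _ Hgt)). unfold filtermap.
    apply filter_imp. intros z Hz; lra. }
  split; intros H.
  - apply (interval_connected a b (fun v => Re (Gam v) < -1/4)); auto; lra.
  - apply NNPP; intros N. revert H.
    apply (interval_connected a b (fun v => ~ Re (Gam v) < -1/4)); auto; try lra.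
    intros u Hu NN. generalize (Op1 u Hu (NNPP _ NN)). apply filter_imp. auto.
Qed.

(** * Primitives along paths *)

(** Complex differentiability, tested on real paths: the chain rule, for composition
    with a path and for composition of two functions, is then part of the definition. *)
Definition derivative_along_paths (F F' : C -> C) : Prop :=
  forall (d : R -> C) (u : R) (l : C),
    is_derive_path d u l ->
    is_derive_path (fun v => F (d v)) u (F' (d u) * l)%C.

Lemma along_paths_ext (F F' G G' : C -> C) :
  (forall z, F z = G z) -> (forall z, F' z = G' z) ->
  derivative_along_paths F F' -> derivative_along_paths G G'.
Proof.
  intros H H' HF d u l Hd. rewrite <- H'.
  apply (is_derive_ext (V := C_R_NormedModule) (fun v => F (d v))); [intros; apply H|].
  apply HF, Hd.
Qed.

Lemma along_paths_const (b : C) : derivative_along_paths (fun _ => b) (fun _ => RtoC 0).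
Proof.
  intros d u l _. rewrite Cmult_0_l.
  exact (is_derive_const (K := R_AbsRing) (V := C_R_NormedModule) b u).
Qed.

Lemma along_paths_id : derivative_along_paths (fun z => z) (fun _ => RtoC 1).
Proof. intros d u l H. rewrite Cmult_1_l; exact H. Qed.

Lemma along_paths_plus (F F' G G' : C -> C) :
  derivative_along_paths F F' -> derivative_along_paths G G' ->
  derivative_along_paths (fun z => F z + G z)%C (fun z => F' z + G' z)%C.
Proof.
  intros HF HG d u l H. rewrite Cmult_plus_distr_r.
  exact (is_derive_plus (K := R_AbsRing) (V := C_R_NormedModule) _ _ u _ _
           (HF d u l H) (HG d u l H)).
Qed.

Lemma along_paths_mult (F F' G G' : C -> C) :
  derivative_along_paths F F' -> derivative_along_paths G G' ->
  derivative_along_paths (fun z => F z * G z)%C (fun z => F' z * G z + F z * G' z)%C.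
Proof.
  intros HF HG d u l H.
  generalize (is_derive_Cmult _ _ u _ _ (HF d u l H) (HG d u l H)). intros D.
  replace ((F' (d u) * G (d u) + F (d u) * G' (d u)) * l)%C
    with (F' (d u) * l * G (d u) + F (d u) * (G' (d u) * l))%C by ring.
  exact D.
Qed.

Lemma along_paths_comp (F F' G G' : C -> C) :
  derivative_along_paths F F' -> derivative_along_paths G G' ->
  derivative_along_paths (fun z => F (G z)) (fun z => F' (G z) * G' z)%C.
Proof.
  intros HF HG d u l H. rewrite <- Cmult_assoc.
  exact (HF (fun v => G (d v)) u _ (HG d u l H)).
Qed.

Lemma along_paths_pow (n : nat) :
  derivative_along_paths (fun z => z ^ S n)%C (fun z => RtoC (INR (S n)) * z ^ n)%C.
Proof.
  induction n as [|n IH].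
  - eapply along_paths_ext; [| |exact along_paths_id]; intros z; simpl; ring.
  - eapply along_paths_ext; [| |exact (along_paths_mult _ _ _ _ along_paths_id IH)]; intros z.
    + reflexivity.
    + rewrite (S_INR (S n)), RtoC_plus. simpl Cpow. ring.
Qed.

(** Allowing a monomial factor makes the class stable under multiplication by z, hence
    by polynomials. *)
Definition has_primitives (f : C -> C) : Prop :=
  forall n, exists F, derivative_along_paths F (fun z => z ^ n * f z)%C.

Lemma has_primitives_ext (f g : C -> C) :
  (forall z, f z = g z) -> has_primitives f -> has_primitives g.
Proof.
  intros E Hf n. destruct (Hf n) as [F HF]. exists F.
  eapply along_paths_ext; [| |exact HF]; intros z; [reflexivity|].
  cbv beta; rewrite E; reflexivity.
Qed.

Lemma has_primitives_1 : has_primitives (fun _ => RtoC 1).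
Proof.
  intros n. exists (fun z => / RtoC (INR (S n)) * z ^ S n)%C.
  assert (HN : RtoC (INR (S n)) <> RtoC 0).
  { intros E. apply RtoC_inj in E. revert E. apply not_0_INR. discriminate. }
  eapply along_paths_ext;
    [| |exact (along_paths_mult _ _ _ _ (along_paths_const (/ RtoC (INR (S n))))
                 (along_paths_pow n))]; intros z.
  - reflexivity.
  - cbv beta. rewrite Cmult_0_l, Cplus_0_l, Cmult_assoc, Cinv_l by exact HN. ring.
Qed.

Lemma has_primitives_combine (b c : C) (f g : C -> C) :
  has_primitives f -> has_primitives g -> has_primitives (fun z => b * f z + c * g z)%C.
Proof.
  intros Hf Hg n. destruct (Hf n) as [F HF], (Hg n) as [G HG].
  exists (fun z => b * F z + c * G z)%C.
  eapply along_paths_ext;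
    [| |exact (along_paths_plus _ _ _ _
                 (along_paths_mult _ _ _ _ (along_paths_const b) HF)
                 (along_paths_mult _ _ _ _ (along_paths_const c) HG))];
    intros z; cbv beta; ring.
Qed.

Lemma has_primitives_mul_id (f : C -> C) :
  has_primitives f -> has_primitives (fun z => z * f z)%C.
Proof.
  intros Hf n. destruct (Hf (S n)) as [F HF]. exists F.
  eapply along_paths_ext; [| |exact HF]; intros z; simpl; ring.
Qed.

Lemma has_primitives_mul_poly (n : nat) (b0 b1 b2 b3 : C) (f : C -> C) :
  has_primitives f ->
  has_primitives (fun z => (b0 + b1 * z + b2 * z * z + b3 * z * z * z) ^ n * f z)%C.
Proof.
  intros Hf.
  assert (Step : forall g, has_primitives g ->
    has_primitives (fun z => (b0 + b1 * z + b2 * z * z + b3 * z * z * z) * g z)%C).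
  { intros g H0.
    assert (H1 := has_primitives_mul_id _ H0).
    assert (H2 := has_primitives_mul_id _ H1).
    assert (H3 := has_primitives_mul_id _ H2).
    generalize (has_primitives_combine (RtoC 1) (RtoC 1) _ _
      (has_primitives_combine b0 b1 _ _ H0 H1) (has_primitives_combine b2 b3 _ _ H2 H3)).
    apply has_primitives_ext. intros z; ring. }
  induction n as [|n IH].
  - revert Hf; apply has_primitives_ext. intros z; simpl; ring.
  - generalize (Step _ IH). apply has_primitives_ext. intros z; simpl Cpow; ring.
Qed.

(** The line integral of f dG along a piecewise smooth path: its existence, its bound by
    the supremum of f on the path, and the fundamental theorem of calculus.  The three are
    proved together since each follows the decomposition of the path into smooth pieces.
    The break points do not matter, as an integrand may be changed at the ends of an
    interval. *)
Lemma path_integral (G G' : C -> C) (c : R -> C) (a b : R) :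
  derivative_along_paths G G' -> (forall z, continuous G' z) -> piecewise_C1 c a b ->
  exists L, 0 <= L /\ forall f : C -> C, (forall u, a <= u <= b -> continuous f (c u)) ->
  exists J : C,
    is_RInt (V := C_R_NormedModule)
      (fun u => f (c u) * path_derive (fun v => G (c v)) u)%C a b J /\
    (forall e, (forall u, a <= u <= b -> Cmod (f (c u)) <= e) -> Cmod J <= L * e) /\
    (forall F, derivative_along_paths F (fun z => f z * G' z)%C -> J = (F (c b) - F (c a))%C).
Proof.
  intros HG HG' Hc. induction Hc as [a b d Hab Hd Hcd|a m b H1 IH1 H2 IH2].
  - assert (Hdc := C1_path_continuous d Hd).
    assert (Hsp : forall u, continuous (fun u => G' (d u) * path_derive d u)%C u).
    { intros u. apply continuous_Cmult; [|apply Hd].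
      exact (continuous_comp d G' u (Hdc u) (HG' (d u))). }
    destruct (continuous_ab_maj_consistent (fun u => Cmod (G' (d u) * path_derive d u))
                a b Hab) as [u0 [Hmax _]].
    { intros u _. apply continuous_Cmod, Hsp. }
    set (B := Cmod (G' (d u0) * path_derive d u0)) in *.
    assert (HB : 0 <= B) by apply Cmod_ge_0.
    exists ((b - a) * B). split; [nra|].
    intros f Hf.
    assert (Hpd : forall u, a < u < b ->
      path_derive (fun v => G (c v)) u = (G' (d u) * path_derive d u)%C).
    { intros u Hu.
      apply path_derive_of_is_derive.
      apply (is_derive_ext_loc (V := C_R_NormedModule) (fun v => G (d v))).
      - apply (locally_interval _ u (Finite a) (Finite b)); simpl; try lra.
        intros v Ha Hb. rewrite Hcd by lra. reflexivity.
      - apply HG, C1_path_is_derive, Hd. }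
    assert (Hcont : forall u, a <= u <= b ->
      continuous (fun u => f (d u) * (G' (d u) * path_derive d u))%C u).
    { intros u Hu. apply continuous_Cmult; [|apply Hsp].
      apply (continuous_comp d f u (Hdc u)). rewrite <- Hcd by exact Hu. apply Hf, Hu. }
    assert (Hex : ex_RInt (V := C_R_CompleteNormedModule)
      (fun u => f (d u) * (G' (d u) * path_derive d u))%C a b).
    { apply ex_RInt_continuous. rewrite Rmin_left, Rmax_right by exact Hab. exact Hcont. }
    destruct Hex as [J HJ]. exists J. split; [|split].
    + eapply (is_RInt_ext (V := C_R_NormedModule)); [|exact HJ].
      rewrite Rmin_left, Rmax_right by exact Hab. intros u Hu.
      cbv beta. rewrite Hpd by exact Hu. rewrite Hcd by lra. reflexivity.
    + intros e He. rewrite Cmod_norm.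
      replace ((b - a) * B * e) with ((b - a) * (e * B)) by ring.
      apply (norm_RInt_le_const (V := C_R_NormedModule) _ a b J (e * B) Hab) in HJ; [exact HJ|].
      intros u Hu.
      assert (Cmod (f (d u) * (G' (d u) * path_derive d u)) <= e * B).
      { rewrite Cmod_mult. apply Rmult_le_compat; try apply Cmod_ge_0.
        - rewrite <- Hcd by exact Hu. apply He, Hu.
        - apply Hmax, Hu. }
      rewrite Cmod_norm in H. exact H.
    + intros F HF.
      assert (HI : is_RInt (V := C_R_NormedModule)
        (fun u => f (d u) * (G' (d u) * path_derive d u))%C a b (F (d b) - F (d a))%C).
      { apply (is_RInt_derive (V := C_R_CompleteNormedModule) (fun u => F (d u))).
        - intros u _. rewrite Cmult_assoc. apply HF, C1_path_is_derive, Hd.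
        - rewrite Rmin_left, Rmax_right by exact Hab. exact Hcont. }
      rewrite (Hcd a), (Hcd b) by lra.
      rewrite <- (is_RInt_unique (V := C_R_CompleteNormedModule) _ _ _ _ HJ).
      exact (is_RInt_unique (V := C_R_CompleteNormedModule) _ _ _ _ HI).
  - destruct IH1 as (L1 & HL1 & IH1), IH2 as (L2 & HL2 & IH2).
    apply piecewise_C1_le in H1, H2.
    exists (L1 + L2). split; [lra|]. intros f Hf.
    destruct (IH1 f) as (J1 & I1 & B1 & P1); [intros; apply Hf; lra|].
    destruct (IH2 f) as (J2 & I2 & B2 & P2); [intros; apply Hf; lra|].
    exists (J1 + J2)%C. split; [|split].
    + exact (is_RInt_Chasles (V := C_R_NormedModule) _ _ _ _ _ _ I1 I2).
    + intros e He. eapply Rle_trans; [apply Cmod_triangle|].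
      rewrite Rmult_plus_distr_r.
      apply Rplus_le_compat; [apply B1|apply B2]; intros; apply He; lra.
    + intros F HF. rewrite (P1 F HF), (P2 F HF). ring.
Qed.

(** * Vanishing of the Cauchy integral *)

Lemma along_paths_chebyshev_2 : derivative_along_paths (chebyshev 2) (fun x => 4 * x)%C.
Proof.
  refine (along_paths_ext _ _ _ _ _ _ (along_paths_plus _ _ _ _
    (along_paths_mult _ _ _ _
      (along_paths_mult _ _ _ _ (along_paths_const (RtoC 2)) along_paths_id) along_paths_id)
    (along_paths_const (-1)%C))); intros x.
  - rewrite chebyshev_2. ring.
  - ring.
Qed.

Lemma along_paths_chebyshev_3 :
  derivative_along_paths (chebyshev 3) (fun x => 12 * x * x - 3)%C.
Proof.
  refine (along_paths_ext _ _ _ _ _ _ (along_paths_plus _ _ _ _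
    (along_paths_mult _ _ _ _ (along_paths_const (RtoC 4)) (along_paths_pow 2))
    (along_paths_mult _ _ _ _ (along_paths_const (-3)%C) along_paths_id))); intros x.
  - rewrite chebyshev_3. simpl. ring.
  - simpl. replace (1 + 1 + 1) with 3 by ring. ring.
Qed.

Definition dchebyshev_6 (x : C) : C := (4 * chebyshev 3 x * (12 * x * x - 3))%C.

Lemma along_paths_chebyshev_6 : derivative_along_paths (chebyshev 6) dchebyshev_6.
Proof.
  refine (along_paths_ext _ _ _ _ _ _
    (along_paths_comp _ _ _ _ along_paths_chebyshev_2 along_paths_chebyshev_3)); intros x.
  - rewrite chebyshev_6_of_chebyshev_3, chebyshev_2. reflexivity.
  - reflexivity.
Qed.

(** P is T_3 o T_2, so T_2 P^n P' dx is w T_3(w)^n T_3'(w) dw for w = T_2(x);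
    symmetrically, the summand with T_3 is a differential in v = T_3(x).  The primitive
    is therefore a function of (T_2(x), T_3(x)), so it does not separate the ends of the
    curve. *)
Lemma moment_primitive (n : nat) :
  exists F,
    derivative_along_paths F
      (fun x => (chebyshev 2 x + chebyshev 3 x) * chebyshev 6 x ^ n * dchebyshev_6 x)%C /\
    forall x y, chebyshev 2 x = chebyshev 2 y -> chebyshev 3 x = chebyshev 3 y -> F x = F y.
Proof.
  (* The coefficients of T_3(w) = 4w^3 - 3w and T_3'(w) = 12w^2 - 3, then those of
     T_2(v) = 2v^2 - 1 and T_2'(v) = 4v; the final 1 is the exponent of the remaining
     factor w or v. *)
  destruct (has_primitives_mul_poly n (RtoC 0) (- (3))%C (RtoC 0) (RtoC 4) _
    (has_primitives_mul_poly 1 (- (3))%C (RtoC 0) (RtoC 12) (RtoC 0) _ has_primitives_1)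
    1%nat) as [F2 H2].
  destruct (has_primitives_mul_poly n (- (1))%C (RtoC 0) (RtoC 2) (RtoC 0) _
    (has_primitives_mul_poly 1 (RtoC 0) (RtoC 4) (RtoC 0) (RtoC 0) _ has_primitives_1)
    1%nat) as [F3 H3].
  exists (fun x => F2 (chebyshev 2 x) + F3 (chebyshev 3 x))%C. split.
  - refine (along_paths_ext _ _ _ _ _ _ (along_paths_plus _ _ _ _
      (along_paths_comp _ _ _ _ H2 along_paths_chebyshev_2)
      (along_paths_comp _ _ _ _ H3 along_paths_chebyshev_3))); intros x; [reflexivity|].
    cbv beta.
    replace (0 + - (3) * chebyshev 2 x + 0 * chebyshev 2 x * chebyshev 2 x +
      4 * chebyshev 2 x * chebyshev 2 x * chebyshev 2 x)%C with (chebyshev 6 x)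
      by (rewrite chebyshev_6_of_chebyshev_2; ring).
    replace (- (1) + 0 * chebyshev 3 x + 2 * chebyshev 3 x * chebyshev 3 x +
      0 * chebyshev 3 x * chebyshev 3 x * chebyshev 3 x)%C with (chebyshev 6 x)
      by (rewrite chebyshev_6_of_chebyshev_3; ring).
    unfold dchebyshev_6. generalize (chebyshev 6 x ^ n)%C; intros p.
    rewrite chebyshev_2, chebyshev_3. simpl. ring.
  - intros x y E2 E3. rewrite E2, E3. reflexivity.
Qed.

(** Let f_n = Q (P / t)^n / (P - t).  Then f_(n+1) - f_n = Q P^n / t^(n+1) has integral zero
    against dP by [moment_primitive], so all the f_n have the same integral, while f_n is
    bounded by a multiple of 2^(-n) on the path. *)
Lemma vanishing_integral (c : R -> C) :
  piecewise_C1 c 0 1 ->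
  chebyshev 2 (c 0) = chebyshev 2 (c 1) -> chebyshev 3 (c 0) = chebyshev 3 (c 1) ->
  exists M, forall t : C, M < Cmod t ->
  is_RInt (V := C_R_NormedModule)
    (fun u => (chebyshev 2 (c u) + chebyshev 3 (c u)) / (chebyshev 6 (c u) - t)
              * path_derive (fun v => chebyshev 6 (c v)) u)%C 0 1 (RtoC 0).
Proof.
  intros Hc E2 E3.
  set (P := chebyshev 6). set (Q := fun x => (chebyshev 2 x + chebyshev 3 x)%C).
  assert (cP : forall z, continuous P z) by (intros z; apply continuous_chebyshev).
  assert (cQ : forall z, continuous Q z).
  { intros z; apply continuous_Cplus; apply continuous_chebyshev. }
  destruct (piecewise_C1_bounded P c 0 1 cP Hc) as [BP HP].
  destruct (piecewise_C1_bounded Q c 0 1 cQ Hc) as [BQ HQ].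
  assert (HBP : 0 <= BP).
  { eapply Rle_trans; [|apply (HP 0); lra]. apply Cmod_ge_0. }
  assert (HBQ : 0 <= BQ).
  { eapply Rle_trans; [|apply (HQ 0); lra]. apply Cmod_ge_0. }
  assert (cP' : forall z, continuous dchebyshev_6 z).
  { intros z. unfold dchebyshev_6, Cminus.
    apply continuous_Cmult; [|apply continuous_Cplus; [|apply continuous_const]].
    - apply continuous_Cmult; [apply continuous_const|apply continuous_chebyshev].
    - apply continuous_Cmult; [|apply continuous_id].
      apply continuous_Cmult; [apply continuous_const|apply continuous_id]. }
  destruct (path_integral P dchebyshev_6 c 0 1 along_paths_chebyshev_6 cP' Hc)
    as (L & HL & HI).
  (* This bound gives both |P / t| <= 1/2 and |P - t| >= 1 on the path. *)
  exists (2 * (BP + 1)). intros t Ht.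
  assert (Ht0 : t <> RtoC 0).
  { intros ->. rewrite Cmod_0 in Ht; lra. }
  assert (HPt : forall u, 0 <= u <= 1 -> 1 <= Cmod (P (c u) - t)).
  { intros u Hu. generalize (HP u Hu) (Cmod_triangle (P (c u)) (t - P (c u))).
    replace (P (c u) + (t - P (c u)))%C with t by ring.
    replace (t - P (c u))%C with (- (P (c u) - t))%C by ring. rewrite Cmod_opp. lra. }
  assert (HPne : forall u, 0 <= u <= 1 -> (P (c u) - t)%C <> RtoC 0).
  { intros u Hu E. generalize (HPt u Hu). rewrite E, Cmod_0; lra. }
  set (f := fun n x => (Q x * (P x * / t) ^ n * / (P x - t))%C).
  assert (cf : forall n u, 0 <= u <= 1 -> continuous (f n) (c u)).
  { intros n u Hu. unfold f. apply continuous_Cmult.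
    - apply continuous_Cmult; [apply cQ|]. apply continuous_Cpow, continuous_Cmult;
        [apply cP|apply continuous_const].
    - apply continuous_Cinv; [|apply HPne, Hu].
      apply continuous_Cplus; [apply cP|apply continuous_const]. }
  assert (Hf : forall n u, 0 <= u <= 1 -> Cmod (f n (c u)) <= BQ * (/ 2) ^ n).
  { intros n u Hu. unfold f. rewrite !Cmod_mult, Cmod_pow, Cmod_mult, !Cmod_inv; auto.
    assert (Hn : (Cmod (P (c u)) * / Cmod t) ^ n <= (/ 2) ^ n).
    { apply pow_incr. split.
      - apply Rmult_le_pos; [apply Cmod_ge_0|]. left; apply Rinv_0_lt_compat; lra.
      - apply Rmult_le_reg_r with (Cmod t); [lra|].
        rewrite Rmult_assoc, Rinv_l by lra. generalize (HP u Hu); lra. }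
    assert (0 <= (Cmod (P (c u)) * / Cmod t) ^ n).
    { apply pow_le, Rmult_le_pos; [apply Cmod_ge_0|]. left; apply Rinv_0_lt_compat; lra. }
    assert (Hi : / Cmod (P (c u) - t) <= 1).
    { rewrite <- Rinv_1. apply Rinv_le_contravar; [lra|apply HPt, Hu]. }
    assert (0 <= / Cmod (P (c u) - t)).
    { left; apply Rinv_0_lt_compat. generalize (HPt u Hu); lra. }
    rewrite <- (Rmult_1_r (BQ * _)).
    apply Rmult_le_compat; try assumption.
    - apply Rmult_le_pos; [apply Cmod_ge_0|assumption].
    - apply Rmult_le_compat; try assumption; [apply Cmod_ge_0|apply HQ, Hu]. }
  set (p := path_derive (fun v => P (c v))) in *.
  destruct (HI (f O) (cf O)) as (J & IJ & _).
  assert (All : forall n, is_RInt (V := C_R_NormedModule) (fun u => f n (c u) * p u)%C 0 1 J).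
  { induction n as [|n IH]; [exact IJ|].
    destruct (moment_primitive n) as (F & HF & HFe).
    set (h := fun x => (Q x * P x ^ n * (/ t) ^ S n)%C).
    destruct (HI h) as (Jh & IJh & _ & FTC).
    { intros u _. apply continuous_Cmult; [|apply continuous_const].
      apply continuous_Cmult; [apply cQ|apply continuous_Cpow, cP]. }
    assert (Jh0 : Jh = RtoC 0).
    { rewrite (FTC (fun x => (/ t) ^ S n * F x)%C).
      - rewrite (HFe (c 1) (c 0)) by (symmetry; assumption). ring.
      - refine (along_paths_ext _ _ _ _ _ _
          (along_paths_mult _ _ _ _ (along_paths_const ((/ t) ^ S n)%C) HF)); intros x.
        + reflexivity.
        + unfold h, Q, P. cbv beta. ring. }
    generalize (is_RInt_plus (V := C_R_NormedModule) _ _ _ _ _ _ IH IJh).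
    rewrite Jh0.
    replace (plus (J : C_R_NormedModule) (RtoC 0 : C_R_NormedModule)) with J.
    2: { apply injective_projections; simpl; symmetry; apply Rplus_0_r. }
    apply (is_RInt_ext (V := C_R_NormedModule)).
    rewrite Rmin_left, Rmax_right by lra. intros u Hu.
    change (f n (c u) * p u + h (c u) * p u = f (S n) (c u) * p u)%C.
    rewrite <- Cmult_plus_distr_r. f_equal.
    unfold f, h. rewrite !Cpow_mult_l. simpl Cpow.
    rewrite Cpow_inv by exact Ht0.
    generalize (HPne u ltac:(lra)) (Cpow_nz t n Ht0). intros N1 N2. field. auto. }
  replace (RtoC 0) with J.
  - apply (is_RInt_ext (V := C_R_NormedModule) (fun u => f O (c u) * p u)%C); [|exact IJ].
    intros u _. unfold f, Q, Cdiv. simpl Cpow. rewrite Cmult_1_r. reflexivity.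
  - apply (Cmod_zero_of_geometric J (L * BQ)). intros n.
    destruct (HI (f n) (cf n)) as (Jn & IJn & Bn & _).
    replace J with Jn.
    + rewrite Rmult_assoc. apply Bn, Hf.
    + rewrite <- (is_RInt_unique (V := C_R_CompleteNormedModule) _ _ _ _ (All n)).
      symmetry. exact (is_RInt_unique (V := C_R_CompleteNormedModule) _ _ _ _ IJn).
Qed.

(** * The two branches at the base point of the curve *)

Theorem theorem4p16 :
  let P : C -> C := chebyshev 6 in
  let Q : C -> C := fun x => (chebyshev 2 x + chebyshev 3 x)%C in
  exists delta : R, 0 < delta /\
  forall (Gam : R -> C), small_upward_shift (sqrt 3 / 2) delta Gam ->
  forall (phi : R -> C -> C), inverse_branch_along P Gam phi ->
  let gam : R -> C := fun u => P (Gam u) in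
  let g : R -> C -> C := fun u z => Q (phi u z) in
  (gam 0 = RtoC (-1) /\ gam 1 = RtoC (-1)) /\
  g 0 (gam 0) = Q (RtoC (- (sqrt 3 / 2))) /\
  (exists M : R, forall t : C, M < Cmod t -> is_cauchy_integral gam g t (RtoC 0)) /\
  (exists r : R, 0 < r /\
    forall s s' : R, 0 < s < 1 -> 0 < s' < 1 ->
      (forall u, 0 <= u <= s -> Cmod (gam u - RtoC (-1)) < r) ->
      (forall u, s' <= u <= 1 -> Cmod (gam u - RtoC (-1)) < r) ->
      let U : C -> Prop :=
        fun z => Cmod (z - RtoC (-1)) < r /\ z <> RtoC (-1) in
      ~ obtained_within U (gam s) (g s) (gam s') (g s') /\
      ~ obtained_within U (gam s') (g s') (gam s) (g s)).
Proof.
  intros P Q. exists 1. split; [lra|].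
  intros Gam [HC1 Hstart Hend _ _] phi [_ Hinv Hval] gam g.
  assert (Hsq : sqrt 3 * sqrt 3 = 3) by (apply sqrt_sqrt; lra).
  assert (Hsq1 : 1 < sqrt 3) by (generalize (sqrt_pos 3); nra).
  (* [e] is the sign distinguishing the two ends of the curve. *)
  assert (HT2 : forall e, e * e = 1 -> chebyshev 2 (RtoC (e * (sqrt 3 / 2))) = RtoC (1 / 2)).
  { intros e He. rewrite chebyshev_2. apply injective_projections; simpl; [|ring].
    transitivity (e * e * (sqrt 3 * sqrt 3) / 2 - 1); [field|].
    rewrite He, Hsq. field. }
  assert (HT3 : forall e, e * e = 1 -> chebyshev 3 (RtoC (e * (sqrt 3 / 2))) = RtoC 0).
  { intros e He. rewrite chebyshev_3. apply injective_projections; simpl; [|ring].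
    transitivity (e * (sqrt 3 / 2) * (e * e * (sqrt 3 * sqrt 3) - 3)); [field|].
    rewrite He, Hsq. ring. }
  replace (- (sqrt 3 / 2)) with (-1 * (sqrt 3 / 2)) in * by ring.
  assert (Hend' : Gam 1 = RtoC (1 * (sqrt 3 / 2))) by (rewrite Rmult_1_l; exact Hend).
  assert (Hg : forall u, 0 <= u <= 1 -> g u (gam u) = Q (Gam u)).
  { intros u Hu. unfold g, gam. rewrite Hval by exact Hu. reflexivity. }
  split; [|split; [|split]].
  - unfold gam, P. rewrite Hstart, Hend', !chebyshev_6_of_chebyshev_3, !HT3 by ring.
    split; apply injective_projections; simpl; ring.
  - rewrite Hg by lra. rewrite Hstart. reflexivity.
  - destruct (vanishing_integral Gam HC1) as [M HM].
    { rewrite Hstart, Hend', !HT2 by ring. reflexivity. }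
    { rewrite Hstart, Hend', !HT3 by ring. reflexivity. }
    exists M. intros t Ht. exists (RtoC 0). split; [|ring].
    apply (is_RInt_ext (V := C_R_NormedModule)) with (2 := HM t Ht).
    rewrite Rmin_left, Rmax_right by lra. intros u Hu.
    rewrite Hg by lra. reflexivity.
  - (* the radius of the disc in [separating_line] *)
    exists (1 / 2). split; [lra|].
    intros s s' Hs Hs' Hnear Hnear'.
    assert (Hcont : forall a b, 0 <= a -> b <= 1 -> forall u A, a <= u <= b ->
      locally (Gam u) A -> within (fun v => a <= v <= b) (locally u) (fun v => A (Gam v))).
    { intros a b Ha Hb u A Hu HA.
      generalize (piecewise_C1_continuous Gam 0 1 A HC1 u ltac:(lra) HA).
      unfold within. apply filter_imp. intros v Hv Dv. apply Hv; lra. }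
    assert (HL : Re (Gam s) < -1/4).
    { apply (shift_side Gam 0 s (Hcont 0 s ltac:(lra) ltac:(lra)) Hnear ltac:(lra)).
      rewrite Hstart. simpl. lra. }
    assert (HR : ~ Re (Gam s') < -1/4).
    { rewrite (shift_side Gam s' 1 (Hcont s' 1 ltac:(lra) ltac:(lra)) Hnear' ltac:(lra)).
      rewrite Hend'. simpl. lra. }
    assert (Hbr : forall u, 0 < u < 1 ->
      locally (gam u) (fun z => branch_equation (g u z) z = RtoC 0)).
    { intros u Hu. generalize (Hinv u Hu). unfold germ_eq.
      apply filter_imp. intros z Hz.
      replace (branch_equation (g u z) z) with (branch_equation (g u z) (P (phi u z)))
        by (rewrite Hz; reflexivity).
      apply branch_equation_of_preimage. }
    assert (Hgs := Hg s ltac:(lra)). assert (Hgs' := Hg s' ltac:(lra)).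
    intros U; split; intros H.
    + apply HR.
      apply (obtained_within_same_side (Gam s) (Gam s') (g s) (g s') (Hbr s Hs) Hgs Hgs' H).
      exact HL.
    + apply HR.
      apply (obtained_within_same_side (Gam s') (Gam s) (g s') (g s) (Hbr s' Hs') Hgs' Hgs H).
      exact HL.
Qed.
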